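(* Let $K$ be a finite field with $q$ elements. Let $G$ be the parallel composition of $r\geq 2$ paths whose lengths have mixed parities (that is, at least one path has odd length and at least one has even length), and let $X$ be the projective toric subset parameterized by $G$. Let $H_1$ be the parallel composition of the paths of odd lengths and let $H_2$ be the parallel composition of the paths of even lengths, and let $X_1$, $X_2$, respectively, be the projective toric subsets they parameterize. Then $$ \operatorname{reg} K[E_G]/I(X) = \operatorname{reg} K[E_{H_1}]/I(X_1) + \operatorname{reg} K[E_{H_2}]/I(X_2) + (q-2). $$
   Context: Graphs are finite, undirected and without loops; multiple edges are allowed. $V_G$ and $E_G$ denote the vertex set and edge set of $G$. The length of a path is its number of edges (all lengths are at least $1$). Parallel composition: given pairwise disjoint paths, each with a chosen first and last endpoint, their parallel composition is the graph obtained by identifying all the first vertices with each other and all the last vertices with each other (no other identifications are made). Multiple edges arise if more than one path has length $1$. The parallel composition of a single path is that path itself; the cases where only one path has odd length, or only one path has even length, are included in the statement. For a graph $G$ with $s=|E_G|\geq 1$ edges, fix an identification of $E_G$ with the variables $t_1,\dots,t_s$ of the standard graded polynomial ring $K[t_1,\dots,t_s]$, which is then denoted $K[E_G]$. For $\mathbf{x}=(x_v)_{v\in V_G}\in (K^* )^{V_G}$ and an edge $t_i=\{v,w\}$ put $\mathbf{x}^{t_i}=x_vx_w$. The projective toric subset parameterized by $G$ is $$X=\{(\mathbf{x}^{t_1},\dots,\mathbf{x}^{t_s})\in \mathbb{P}^{s-1}(K) \mid \mathbf{x}\in (K^* )^{V_G}\},$$ and $I(X)\subset K[E_G]$ is its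 vanishing ideal, i.e. the ideal generated by all homogeneous polynomials vanishing on $X$. The same definitions apply to $H_1$ and $H_2$, with $I(X_i)\subset K[E_{H_i}]$. The Castelnuovo--Mumford regularity of a finitely generated graded module $M$ over a standard graded polynomial ring $S$, with minimal graded free resolution $0\to F_c\to\cdots\to F_0\to M\to 0$, $F_i\cong\bigoplus_{j} S(-j)^{b_{ij}}$, is $\operatorname{reg} M=\max\{j-i \mid b_{ij}\neq 0\}$. Here $K[E_G]/I(X)$ is regarded as a graded $K[E_G]$-module, and $K[E_{H_i}]/I(X_i)$ as a graded $K[E_{H_i}]$-module. *)

(* Defs.v *)
From HB Require Import structures.
From Stdlib Require Import ClassicalEpsilon.
From mathcomp Require Import all_boot all_order all_algebra.
From mathcomp Require Import mpoly.

Set Implicit Arguments.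
Unset Strict Implicit.
Unset Printing Implicit Defensive.

Import Order.TTheory GRing.Theory Num.Theory.
Local Open Scope ring_scope.

(* Edges carry their own identity, so multiple edges are allowed; an edge has
   exactly two ends, so loops are not. *)
Record mgraph := MGraph {
  vertex : finType;
  edge : finType;
  ends : edge -> {set vertex};
  card_ends : forall e, #|ends e| = 2%N
}.

Definition path_ends n (k : 'I_n) : {set 'I_n.+1} :=
  [set widen_ord (leqnSn n) k; lift ord0 k].

Lemma card_path_ends n (k : 'I_n) : #|path_ends k| = 2%N.
Proof.
by rewrite cards2 -val_eqE /= /bump add1n neq_ltn ltnSn.
Qed.

(* The path with n edges: its k-th edge joins the vertices k and k + 1. *)
Definition path_graph n : mgraph := MGraph (@card_path_ends n).

(* G is obtained from the disjoint union of the graphs P i by identifying all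
   the vertices a i with each other and all the vertices b i with each other,
   with no other identifications: phi is the quotient map on vertices and psi
   the resulting bijection on edges. *)
Definition is_parallel_composition (I : finType) (P : I -> mgraph)
    (a b : forall i, vertex (P i)) (G : mgraph) : Prop :=
  exists (phi : {i : I & vertex (P i)} -> vertex G)
         (psi : {i : I & edge (P i)} -> edge G),
    [/\ forall v, exists u, phi u = v,
        forall u w, phi u = phi w <->
          [\/ u = w,
              tagged u = a (tag u) /\ tagged w = a (tag w) |
              tagged u = b (tag u) /\ tagged w = b (tag w)],
        bijective psi &
        forall i (e : edge (P i)),
          ends (psi (existT _ i e)) =
          [set phi (existT _ i v) | v in ends e]].

Definition is_parallel_composition_of_paths (I : finType) (len : I -> nat)
    (G : mgraph) : Prop :=
  @is_parallel_composition I (fun i => path_graph (len i))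
    (fun i => @ord0 (len i)) (fun i => @ord_max (len i)) G.

Definition nb_edges (G : mgraph) : nat := #|edge G|.

Definition edge_monomial (K : comNzRingType) (G : mgraph) (x : vertex G -> K)
    (e : edge G) : K :=
  \prod_(v in ends e) x v.

(* A subset of projective space is given by the set of the homogeneous
   coordinate vectors of its points, hence the scalar c.  The variable 'X_i
   stands for the i-th edge in the enumeration of [edge G]. *)
Definition toric_subset (K : fieldType) (G : mgraph)
    (p : 'I_(nb_edges G) -> K) : Prop :=
  exists (x : vertex G -> K) (c : K),
    [/\ forall v, x v != 0, c != 0 &
        forall i, p i = c * edge_monomial x (enum_val i)].

Definition ideal_generated (R : comNzRingType) (A : R -> Prop) (p : R) : Prop :=
  exists (k : nat) (g f : 'I_k -> R),
    (forall i, A (f i)) /\ p = \sum_i g i * f i.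

Definition vanishing_ideal (K : fieldType) n (X : ('I_n -> K) -> Prop) :
    {mpoly K[n]} -> Prop :=
  ideal_generated (fun f : {mpoly K[n]} =>
    (exists d : nat, f \is d.-homog) /\ (forall p, X p -> f.@[p] = 0)).

Definition homog_of_degree (K : fieldType) n (e : int) (p : {mpoly K[n]}) :
    Prop :=
  match e with Posz d => p \is d.-homog | Negz _ => p = 0 end.

(* Graded free modules F_i, the direct sum over k of S(- shift i k), and maps
   F_{i+1} -> F_i given by matrices acting on row vectors, together with a map
   F_0 -> S whose composite with S -> S/I is the augmentation. *)
Record graded_free_data (K : fieldType) (n : nat) := GradedFreeData {
  rk : nat -> nat;
  shift : forall i, 'I_(rk i) -> int;
  diff : forall i, 'M[{mpoly K[n]}]_(rk i.+1, rk i);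
  augm : 'cV[{mpoly K[n]}]_(rk 0)
}.

Definition is_graded (K : fieldType) n (F : graded_free_data K n) : Prop :=
  (forall i k l, homog_of_degree (shift k - shift l) (diff F i k l)) /\
  (forall k, homog_of_degree (shift k) (augm F k 0)).

(* Exactness of ... -> F_1 -> F_0 -> S/I -> 0. *)
Definition is_resolution (K : fieldType) n (I : {mpoly K[n]} -> Prop)
    (F : graded_free_data K n) : Prop :=
  [/\ forall p, exists w : 'rV_(rk F 0), I (p - (w *m augm F) 0 0),
      forall w : 'rV_(rk F 0),
        I ((w *m augm F) 0 0) <-> exists u, w = u *m diff F 0 &
      forall i (w : 'rV_(rk F i.+1)),
        w *m diff F i = 0 <-> exists u, w = u *m diff F i.+1].

Definition has_finite_length (K : fieldType) n (F : graded_free_data K n) :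
    Prop :=
  exists c : nat, forall i, (c < i)%N -> rk F i = 0%N.

(* The image of F_{i+1} lies in (t_1, ..., t_n) F_i. *)
Definition is_minimal (K : fieldType) n (F : graded_free_data K n) : Prop :=
  forall i k l, (diff F i k l)@_0%MM = 0.

Definition betti (K : fieldType) n (F : graded_free_data K n) (i : nat)
    (j : int) : nat :=
  #|[set k : 'I_(rk F i) | shift k == j]|.

Definition is_max_degree (K : fieldType) n (F : graded_free_data K n)
    (r : int) : Prop :=
  (exists i j, betti F i j != 0%N /\ r = j - i%:Z) /\
  (forall i j, betti F i j != 0%N -> j - i%:Z <= r).

Definition is_regularity (K : fieldType) n (I : {mpoly K[n]} -> Prop)
    (r : int) : Prop :=
  exists F : graded_free_data K n,
    [/\ is_graded F, is_resolution I F, has_finite_length F, is_minimal F &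
        is_max_degree F r].

(* reg S/I, for S = K[t_1, ..., t_n] and a proper homogeneous ideal I.  A
   finite minimal graded free resolution of S/I exists (Hilbert's syzygy
   theorem) and is unique up to isomorphism, so exactly one r satisfies
   [is_regularity I r]; the default value is not used. *)
Definition regularity (K : fieldType) n (I : {mpoly K[n]} -> Prop) : int :=
  epsilon (inhabits (0 : int)) (is_regularity I).

(* Main.v *)
Require Import Defs.
From HB Require Import structures.
From Stdlib Require Import Classical ClassicalEpsilon FunctionalExtensionality.
From mathcomp Require Import all_boot all_order all_algebra finfield.
From mathcomp Require Import mpoly.
From mathcomp Require Import zify ring.

(* Let Y in K^E be the cone over X, and say that Y is full in degree d when
   every function f on Y with f(c p) = c^d f(p) is a form of degree d. Since a
   variable t is invertible on X, S/I(X) is Cohen-Macaulay of dimension 1, so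
   its regularity is the top degree of S/(I(X), t), which is the least degree
   in which Y is full. This is obtained from the Koszul complex: shifting along
   the syzygies of a minimal resolution F, F_i has a generator of degree j if
   and only if H_i(t_1, ..., t_n; S/I) is nonzero in degree j; the same
   criterion bounds the degrees and the homological positions of generators,
   and so shows that a finite minimal resolution exists.
   For the parallel composition, rescaling the vertex values of each path
   alternately shows that the cone of G is the product Y1 x Y2 of those of H1
   and H2. With r1, r2 the least full degrees, Y1 x Y2 is full in every degree
   d >= r1 + r2 + q - 2: indicators of lines are the sums, over q - 1
   consecutive k, of products of indicators in the degrees r1 + k on Y1 and
   d - r1 - k on Y2. It is not full in degree r1 + r2 + q - 3: there is a
   functional on the functions on Yi vanishing on the forms of degree less than
   ri + q - 2 but not on all functions of that weight, and the tensor product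
   of these two functionals vanishes on all forms of degree r1 + r2 + q - 3. *)

Set Implicit Arguments.
Unset Strict Implicit.
Unset Printing Implicit Defensive.

Import Order.TTheory GRing.Theory Num.Theory.
Local Open Scope ring_scope.

(** * Power sums over a finite field *)

Section FiniteField.

Variable K : finFieldType.
Local Notation q := #|K|.

Lemma card_gt1 : (1 < q)%N. Proof. exact: finNzRing_gt1. Qed.

Lemma card_natr : q%:R = 0 :> K.
Proof.
(* Translation by 1 permutes [K], while it adds [q%:R] to the sum. *)
have : \sum_(x : K) x = \sum_(x : K) (x + 1).
  by rewrite (reindex_inj (addIr 1)).
rewrite big_split /= sumr_const => /eqP.
by rewrite -subr_eq0 opprD addrA subrr sub0r oppr_eq0 => /eqP.
Qed.

Lemma predn_card_natr : q.-1%:R = -1 :> K.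
Proof.
apply/eqP; rewrite -addr_eq0 -mulrSr prednK ?card_natr //.
exact: ltnW card_gt1.
Qed.

Lemma expf_predn_card (x : K) : x != 0 -> x ^+ q.-1 = 1.
Proof.
move=> x0; apply: (mulfI x0); rewrite -exprS prednK ?expf_card ?mulr1 //.
exact: ltnW card_gt1.
Qed.

Lemma expf_dvdn (x : K) m : x != 0 -> (q.-1 %| m)%N -> x ^+ m = 1.
Proof.
by move=> x0 /dvdnP[k ->]; rewrite mulnC exprM expf_predn_card // expr1n.
Qed.

Lemma sum_geometric (x : K) : x != 0 ->
  \sum_(k < q.-1) x ^+ k = if x == 1 then -1 else 0.
Proof.
move=> x0; case: eqP => [->|/eqP x1].
  under eq_bigr do rewrite expr1n.
  by rewrite sumr_const card_ord predn_card_natr.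
have /eqP := subrX1 x q.-1.
rewrite expf_predn_card // subrr eq_sym mulf_eq0 subr_eq0 (negPf x1).
by move=> /eqP.
Qed.

(** If [y ^+ m != 1] for some nonzero [y], then substituting [y * x] for [x] multiplies the sum by
    [y ^+ m], so the sum is 0. Such a [y] exists when [q.-1] does not divide [m], since
    ['X^(m %% q.-1) - 1] has fewer than [q.-1] roots. *)
Lemma sum_powers m :
  \sum_(x : K | x != 0) x ^+ m = if (q.-1 %| m)%N then -1 else 0.
Proof.
case: ifPn => [dv|ndv].
  rewrite (eq_bigr (fun=> 1)) => [|x x0]; last exact: expf_dvdn.
  rewrite sumr_const -predn_card_natr; congr _%:R.
  by rewrite -(cardC1 (0 : K)); apply: eq_card.
have [y y0 ym] : exists2 y : K, y != 0 & y ^+ m != 1.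
  apply/exists_inP; apply: contraR ndv; rewrite negb_exists_in => /forall_inP h.
  have q0 : (0 < q.-1)%N by rewrite -ltnS prednK ?card_gt1 // ltnW // card_gt1.
  rewrite /dvdn; apply: contraT; rewrite -lt0n => b0.
  have /max_poly_roots : 'X^(m %% q.-1) - 1 != 0 :> {poly K}.
    by rewrite -size_poly_eq0 -[1]/(1%:P) size_XnsubC.
  move=> /(_ (enum (predC1 (0 : K)))).
  rewrite -cardE cardC1 -[1]/(1%:P) size_XnsubC // ltnS leqNgt ltn_pmod //.
  apply=> //; last exact: enum_uniq.
  apply/allP => y; rewrite mem_enum => y0; rewrite rootE !hornerE.
  have := h y y0; rewrite negbK {1}(divn_eq m q.-1) exprD mulnC exprM.
  by rewrite expf_predn_card // expr1n mul1r => /eqP ->; rewrite subrr.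
have : y ^+ m * \sum_(x : K | x != 0) x ^+ m = \sum_(x : K | x != 0) x ^+ m.
  rewrite mulr_sumr [RHS](reindex_inj (mulfI y0)) /=.
  by apply: eq_big => [x|x _]; rewrite ?mulf_eq0 ?(negPf y0) // exprMn.
move=> /eqP; rewrite -subr_eq0 -{2}[\sum_(x | _) _]mul1r -mulrBl mulf_eq0.
by rewrite subr_eq0 (negPf ym) => /eqP.
Qed.

End FiniteField.

(** As [K] and [T] are finite, the elements of [A] can be listed as the rows of a matrix, functions
    outside [A] being replaced by 0. A column of its cokernel matrix that does not kill [phi] is the
    functional sought. *)
Lemma dual_separation (K : finFieldType) (T : finType) (A : (T -> K) -> Prop)
    (phi : T -> K) :
  A (fun=> 0) -> (forall c f g, A f -> A g -> A (fun x => c * f x + g x)) ->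
  ~ A phi -> exists la : T -> K,
    (forall f, A f -> \sum_x la x * f x = 0) /\ \sum_x la x * phi x != 0.
Proof.
move=> A0 Alin nA.
pose inA (f : {ffun T -> K}) : bool :=
  if excluded_middle_informative (A f) then true else false.
have inAP (f : {ffun T -> K}) : reflect (A f) (inA f).
  by rewrite /inA; case: excluded_middle_informative => ?; constructor.
pose M := \matrix_(i < #|{ffun T -> K}|, j < #|T|)
  (if inA (enum_val i) then enum_val i (enum_val j) else 0).
pose v := \row_(j < #|T|) phi (enum_val j).
have sumE (f g : T -> K) :
    \sum_(j < #|T|) f (enum_val j) * g (enum_val j) = \sum_x f x * g x.
  by rewrite [RHS](reindex _ (onW_bij _ (@enum_val_bij T))).
have nvM : ~~ (v <= M)%MS.
  apply/negP => /submxP[c ec]; apply: nA.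
  have -> : phi = (fun x => \sum_i c 0 i * M i (enum_rank x)).
    apply: functional_extensionality => x.
    have /rowP/(_ (enum_rank x)) := ec.
    by rewrite !mxE enum_rankK.
  have Ai i : A (fun x => M i (enum_rank x)).
    rewrite (_ : (fun _ => _) =
      fun x => if inA (enum_val i) then enum_val i x else 0).
      by case: inAP.
    by apply: functional_extensionality => x; rewrite mxE enum_rankK.
  rewrite [index_enum _]unlock; elim: Finite.enum => [|i r IH].
    rewrite (_ : (fun _ => _) = fun=> 0) //.
    by apply: functional_extensionality => x; rewrite big_nil.
  rewrite (_ : (fun _ => _) = fun x =>
    c 0 i * M i (enum_rank x) + \sum_(j <- r) c 0 j * M j (enum_rank x)).
    exact: Alin.
  by apply: functional_extensionality => x; rewrite big_cons.
rewrite submxE in nvM.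
have [k nk] : exists k, (v *m cokermx M) 0 k != 0.
  apply/existsP; apply: contraR nvM; rewrite negb_exists => /forallP h.
  by apply/eqP/rowP => k; rewrite [RHS]mxE; apply/eqP; rewrite -[_ == _]negbK.
exists (fun x => cokermx M (enum_rank x) k); split=> [f Af|].
  have /matrixP/(_ (enum_rank (finfun f)) k) := mulmx_coker M.
  rewrite mxE [RHS]mxE => eM; rewrite -[RHS]eM -sumE; apply: eq_bigr => j _.
  rewrite enum_valK [M _ _]mxE enum_rankK ffunE mulrC; case: inAP => // -[].
  rewrite (_ : finfun f = f :> (_ -> _)) //.
  by apply: functional_extensionality => x; rewrite ffunE.
move: nk; rewrite mxE -sumE; congr (_ != _).
by apply: eq_bigr => j _; rewrite enum_valK [v _ _]mxE mulrC.
Qed.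

(** * Forms on a cone over a projective set in the torus *)

Section Forms.

Variable K : finFieldType.
Local Notation q := #|K|.

(** The functions induced by forms of degree [d]. Working with functions instead of polynomials
    permits induction on them and index sets without an enumeration. *)
Inductive is_form (E : Type) : nat -> ((E -> K) -> K) -> Prop :=
| is_form0 d : is_form d (fun=> 0)
| is_form1 : is_form 0 (fun=> 1)
| is_formX d e h : is_form d h -> is_form d.+1 (fun p => p e * h p)
| is_formZD d c h1 h2 :
    is_form d h1 -> is_form d h2 -> is_form d (fun p => c * h1 p + h2 p).

Section FormTheory.

Variable E : Type.
Implicit Types (h : (E -> K) -> K) (p : E -> K).

Lemma is_form_ext d h1 h2 : h1 =1 h2 -> is_form d h1 -> is_form d h2.
Proof. by move=> /functional_extensionality ->. Qed.

Lemma is_formZ d c h : is_form d h -> is_form d (fun p => c * h p).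
Proof.
move=> fh; apply: is_form_ext (is_formZD c fh (is_form0 _ d)) => p.
by rewrite addr0.
Qed.

Lemma is_formD d h1 h2 :
  is_form d h1 -> is_form d h2 -> is_form d (fun p => h1 p + h2 p).
Proof.
by move=> f1 f2; apply: is_form_ext (is_formZD 1 f1 f2) => p; rewrite mul1r.
Qed.

Lemma is_form_sum d (I : Type) (r : seq I) (P : pred I)
    (h : I -> (E -> K) -> K) :
  (forall i, P i -> is_form d (h i)) ->
  is_form d (fun p => \sum_(i <- r | P i) h i p).
Proof.
move=> fh; elim: r => [|i r IH].
  by apply: is_form_ext (is_form0 _ d) => p; rewrite big_nil.
case Pi: (P i); last by apply: is_form_ext IH => p; rewrite big_cons Pi.
by apply: is_form_ext (is_formD (fh i Pi) IH) => p; rewrite big_cons Pi.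
Qed.

Lemma is_formM d1 d2 h1 h2 : is_form d1 h1 -> is_form d2 h2 ->
  is_form (d1 + d2) (fun p => h1 p * h2 p).
Proof.
move=> f1 f2; elim: f1 => [d||d e h _ IH|d c h h' _ IH _ IH'].
- by apply: is_form_ext (is_form0 _ _) => p; rewrite mul0r.
- by apply: is_form_ext f2 => p; rewrite mul1r.
- by apply: is_form_ext (is_formX e IH) => p; rewrite mulrA.
by apply: is_form_ext (is_formZD c IH IH') => p; rewrite mulrDl mulrA.
Qed.

Lemma is_form_expr d h k : is_form d h -> is_form (k * d) (fun p => h p ^+ k).
Proof.
move=> fh; elim: k => [|k IH]; first exact: is_form1.
by rewrite mulSn; apply: is_form_ext (is_formM fh IH) => p; rewrite exprS.
Qed.

Lemma is_form_prod (I : Type) (r : seq I) (d : I -> nat)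
    (h : I -> (E -> K) -> K) : (forall i, is_form (d i) (h i)) ->
  is_form (\sum_(i <- r) d i) (fun p => \prod_(i <- r) h i p).
Proof.
move=> fh; elim: r => [|i r IH].
  by rewrite big_nil; apply: is_form_ext (is_form1 _) => p; rewrite big_nil.
rewrite big_cons; apply: is_form_ext (is_formM (fh i) IH) => p.
by rewrite big_cons.
Qed.

Lemma is_form_var e : is_form 1 (fun p => p e).
Proof. by apply: is_form_ext (is_formX e (is_form1 _)) => p; rewrite mulr1. Qed.

Lemma is_form_varX e d : is_form d (fun p => p e ^+ d).
Proof. by have := is_form_expr d (is_form_var e); rewrite muln1. Qed.

Lemma is_form_scale d h c p :
  is_form d h -> h (fun e => c * p e) = c ^+ d * h p.
Proof.
elim=> [d'||d' e h' _ IH|d' a h1 h2 _ IH1 _ IH2]; rewrite ?mulr0 ?mulr1 //.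
  by rewrite IH exprS; ring.
by rewrite IH1 IH2; ring.
Qed.

End FormTheory.

Lemma is_form_comp (E E' : Type) (g : E -> E') d h :
  is_form d h -> is_form d (fun p : E' -> K => h (p \o g)).
Proof.
elim=> [d'||d' e h' _ IH|d' c h1 h2 _ IH1 _ IH2].
- exact: is_form0.
- exact: is_form1.
- exact: is_formX.
exact: is_formZD.
Qed.

Definition torus_cone (E : Type) (Y : (E -> K) -> Prop) :=
  [/\ exists p, Y p, forall p, Y p -> forall e, p e != 0 &
      forall c p, c != 0 -> Y p -> Y (fun e => c * p e)].

Definition weighted (E : Type) (Y : (E -> K) -> Prop) d (phi : (E -> K) -> K) :=
  forall c p, c != 0 -> Y p -> phi (fun e => c * p e) = c ^+ d * phi p.

(* The coordinate ring of the projective set with cone Y attains its Hilbert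
   polynomial in degree d. *)
Definition full (E : Type) (Y : (E -> K) -> Prop) d :=
  forall phi, weighted Y d phi ->
  exists h, is_form d h /\ forall p, Y p -> h p = phi p.

Definition regularity_index (E : Type) (Y : (E -> K) -> Prop) r :=
  forall d, full Y d <-> (r <= d)%N.

Section Cone.

Variables (E : finType) (Y : (E -> K) -> Prop) (e0 : E).
Hypothesis coneY : torus_cone Y.

Let Y0 p e : Y p -> p e != 0.
Proof. by case: coneY => _ h _ /h. Qed.

Lemma coneZ c p : c != 0 -> Y p -> Y (fun e => c * p e).
Proof. by case: coneY => _ _; apply. Qed.

Lemma weighted_eq d d' phi :
  d = d' %[mod q.-1] -> weighted Y d phi -> weighted Y d' phi.
Proof.
move=> dd wphi c p c0 Yp; rewrite wphi //.
have e n : c ^+ n = c ^+ (n %% q.-1).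
  by rewrite {1}(divn_eq n q.-1) exprD expf_dvdn ?mul1r // dvdn_mull.
by rewrite e dd -e.
Qed.

(** Division by the coordinate [e0], which vanishes nowhere on [Y], lowers the weight by one. *)
Lemma full_succ d : full Y d -> full Y d.+1.
Proof.
move=> fd phi wphi; have [|h [fh hY]] := fd (fun p => phi p / p e0).
  move=> c p c0 Yp; rewrite wphi // invfM exprS; have := Y0 e0 Yp => pe.
  by field; rewrite c0 pe.
exists (fun p => p e0 * h p); split=> [|p Yp]; first exact: is_formX.
by rewrite hY // mulrC divfK // Y0.
Qed.

Lemma full_leq d d' : (d <= d')%N -> full Y d -> full Y d'.
Proof.
by move=> /subnK <- fd; elim: (d' - d)%N => // k; exact: full_succ.
Qed.

(** Homogenised Lagrange interpolation: for [p] in [Y], [L y p] is 1 if [p] is [p e0] times [y], and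
    0 otherwise. The degree is a multiple of [q.-1], so a function of this weight is constant on
    lines. *)
Lemma full_exists : exists d, full Y d.
Proof.
exists (#|E| * q.-1)%N => phi wphi.
pose L (y p : E -> K) := \prod_(e : E)
  (p e0 ^+ q.-1 - (p e - y e * p e0) ^+ q.-1).
have fL y : is_form (#|E| * q.-1) (L y).
  rewrite -sum_nat_const; apply: is_form_prod => e.
  apply: is_form_ext (is_formZD (-1) _ (is_form_varX e0 _)); last first.
    rewrite -[q.-1]muln1; apply: is_form_expr.
    exact: (is_formZD (- y e) (is_form_var e0) (is_form_var e)).
  by move=> p; rewrite mulN1r addrC mulNr (addrC (p e)).
exists (fun p => \sum_(y : {ffun E -> K}) phi y * L y p).
split=> [|p Yp]; first by apply: is_form_sum => y _; exact: is_formZ.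
have pe := Y0 e0 Yp; pose y0 := [ffun e => (p e0)^-1 * p e].
have q0 : (0 < q.-1)%N by rewrite -subn1 subn_gt0 card_gt1.
rewrite (bigD1 y0) //= big1 => [|y /eqP ny].
  rewrite addr0 /L big1 => [|e _].
    rewrite (_ : fun_of_fin y0 = fun e => (p e0)^-1 * p e); last first.
      by apply: functional_extensionality => e; rewrite ffunE.
    rewrite mulr1 wphi ?invr_eq0 // mulnC exprM.
    by rewrite expf_predn_card ?invr_eq0 ?expr1n ?mul1r.
  rewrite ffunE mulrAC mulVf // mul1r subrr expr0n eqn0Ngt q0 subr0.
  exact: expf_predn_card.
have [e ne] : exists e, y e != y0 e.
  apply/existsP; apply/contra_notT: ny; rewrite negb_exists => /forallP h.
  by apply/ffunP => e; apply/eqP; have := h e; rewrite negbK.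
rewrite /L (bigD1 e) //= !expf_predn_card ?subrr ?mul0r ?mulr0 //.
apply: contra ne; rewrite ffunE subr_eq0 => /eqP ->.
by rewrite mulrCA mulVf // mulr1.
Qed.

Lemma regularity_index_exists : exists r, regularity_index Y r.
Proof.
pose b d := if excluded_middle_informative (full Y d) then true else false.
have bP d : reflect (full Y d) (b d).
  by rewrite /b; case: excluded_middle_informative => ?; constructor.
have exb : exists d, b d by have [d /bP] := full_exists; exists d.
case: (ex_minnP exb) => r /bP fr min; exists r => d; split=> [/bP/min //|].
by move=> /full_leq; exact.
Qed.

Definition separates (y : E -> K) (h : (E -> K) -> K) :=
  h y = 1 /\
  forall z, Y z -> h z != 0 -> exists2 c, c != 0 & z = fun e => c * y e.

(** The function equal to [(z e0 / y e0) ^+ d] on the line of [y] and to 0 elsewhere has weight [d],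
    hence is a form on [Y]. *)
Lemma full_separates d y :
  full Y d -> Y y -> exists2 h, is_form d h & separates y h.
Proof.
move=> fd Yy.
pose prop z := exists2 c, c != 0 & z = (fun e => c * y e) :> (E -> K).
pose phi z :=
  if excluded_middle_informative (prop z) then (z e0 / y e0) ^+ d else 0.
have [|h [fh hY]] := fd phi.
  move=> c p c0 Yp; rewrite /phi.
  case: excluded_middle_informative => [[a a0 ea]|no];
      case: excluded_middle_informative => [pp|no'] //.
  - by rewrite -exprMn mulrA.
  - case: no'; exists (c^-1 * a); first by rewrite mulf_neq0 ?invr_eq0.
    apply: functional_extensionality => e; have := congr1 (fun f => f e) ea.
    by move=> /= /(canRL (mulKf c0)) ->; rewrite mulrA.
  - case: no; case: pp => a a0 ->; exists (c * a); first by rewrite mulf_neq0.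
    by apply: functional_extensionality => e; rewrite mulrA.
  by rewrite mulr0.
exists h => //; split=> [|z Yz].
  rewrite hY // /phi divff ?Y0 // expr1n.
  case: excluded_middle_informative => // -[]; exists 1; rewrite ?oner_eq0 //.
  by apply: functional_extensionality => e; rewrite mul1r.
rewrite hY // /phi; case: (excluded_middle_informative (prop z)) => [pz _|_] //=.
by rewrite eqxx.
Qed.

(** A weighted function is the combination of the separating forms of the points with coordinate 1
    at [e0], one on each line, with its values there as coefficients. *)
Lemma separates_full d :
  (forall y, Y y -> exists2 h, is_form d h & separates y h) -> full Y d.
Proof.
move=> sep phi wphi.
have [h hP] : exists h : {ffun E -> K} -> (E -> K) -> K,
    forall y, is_form d (h y) /\ (Y y -> separates y (h y)).
  apply: (@fin_all_exists {ffun E -> K} (fun=> (E -> K) -> K)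
    (fun y h => is_form d h /\ (Y y -> separates y h))) => y.
  case: (excluded_middle_informative (Y y)) => [Yy|nY].
    by have [h fh sh] := sep y Yy; exists h.
  by exists (fun=> 0); split; [exact: is_form0 | ].
pose b (y : {ffun E -> K}) :=
  if excluded_middle_informative (Y y) then y e0 == 1 else false.
have bP (y : {ffun E -> K}) : reflect (Y y /\ y e0 = 1) (b y).
  rewrite /b; case: excluded_middle_informative => Yy; last by constructor=> -[].
  by apply: (iffP eqP) => [|[]].
exists (fun p => \sum_(y | b y) phi y * h y p); split=> [|z Yz].
  by apply: is_form_sum => y _; apply: is_formZ; case: (hP y).
have ze := Y0 e0 Yz; pose y0 := [ffun e => (z e0)^-1 * z e].
have y0E : fun_of_fin y0 = fun e => (z e0)^-1 * z e.
  by apply: functional_extensionality => e; rewrite ffunE.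
have Yy0 : Y y0 by rewrite y0E; apply: coneZ; rewrite ?invr_eq0.
have by0 : b y0 by apply/bP; rewrite ffunE mulVf.
rewrite (bigD1 y0) //= big1 => [|y /andP[/bP[Yy ye] /eqP ny]].
  have ez : z = fun e => z e0 * y0 e.
    by apply: functional_extensionality => e; rewrite ffunE mulrA divff // mul1r.
  rewrite addr0 [in h y0 z]ez [in RHS]ez wphi //.
  have [/is_form_scale -> /(_ Yy0)[-> _]] := hP y0.
  by rewrite mulr1 mulrC.
apply/eqP/negPn/negP; rewrite mulf_eq0 negb_or => /andP[_].
have [_ /(_ Yy)[_ sy]] := hP y; move=> /(sy z Yz)[c c0 ez].
case: ny; apply/ffunP => e; rewrite ffunE ez ye mulr1 mulrA mulVf ?mul1r //.
Qed.

End Cone.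

End Forms.

(** * Products of cones *)

Section Annihilator.

Variables (K : finFieldType) (E : finType) (Y : (E -> K) -> Prop) (e0 : E).
Hypothesis coneY : torus_cone Y.
Variable r : nat.
Hypothesis regY : regularity_index Y r.
Local Notation q := #|K|.
Local Notation N := (r + (q - 2))%N.

(* When r > 0, N is r - 1 modulo q - 1, and the forms of degree less than N
   in this residue class have degree at most r - 1, where Y is not full. *)
Lemma not_sum_of_forms : exists phi, weighted Y N phi /\
  forall h : nat -> (E -> K) -> K, (forall d, is_form d (h d)) ->
  ~ forall p, Y p -> phi p = \sum_(d < N) h d p.
Proof.
have q1 := card_gt1 K.
have [[p0 Yp0] Y0 YZ] := coneY.
(* [avg] projects to the part of weight [N] modulo [q - 1]; the sign is there because the sum of 1
   over the [q - 1] nonzero scalars is -1. *)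
pose avg (f : (E -> K) -> K) p :=
  - \sum_(c : K | c != 0) (c^-1) ^+ N * f (fun e => c * p e).
have avg_weighted phi p : weighted Y N phi -> Y p -> avg phi p = phi p.
  move=> wphi Yp; rewrite /avg (eq_bigr (fun c : K => c ^+ 0%N * phi p)).
    by rewrite -mulr_suml sum_powers dvdn0 mulN1r opprK.
  by move=> c c0; rewrite wphi // mulrA -exprMn mulVf // expr1n.
have avg_form d h p : is_form d h -> (d < N)%N ->
    avg h p = if (q.-1 %| N - d)%N then h p else 0.
  move=> fh ltd; rewrite /avg (eq_bigr (fun c : K => (c^-1) ^+ (N - d) * h p)).
    rewrite -mulr_suml (reindex_inj invr_inj) /=.
    rewrite (eq_bigr (fun c : K => c ^+ (N - d))) => [|c _]; last by rewrite invrK.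
    under eq_bigl do rewrite invr_eq0.
    by rewrite sum_powers; case: ifP => _; rewrite ?mulN1r ?opprK // mul0r oppr0.
  move=> c c0; rewrite (is_form_scale _ _ fh) mulrA; congr (_ * _).
  by rewrite -[in LHS](subnK (ltnW ltd)) exprD -mulrA -exprMn mulVf // expr1n mulr1.
have avg_sum phi h p : weighted Y N phi -> (forall d, is_form d (h d)) -> Y p ->
    (forall p, Y p -> phi p = \sum_(d < N) h d p) ->
    phi p = \sum_(d < N) if (q.-1 %| N - d)%N then h d p else 0.
  move=> wphi fh Yp e; rewrite -(avg_weighted phi p wphi Yp).
  rewrite (_ : avg phi p = \sum_(d < N) avg (h d) p).
    by apply: eq_bigr => d _; apply: avg_form.
  rewrite /avg sumrN; congr (- _); rewrite exchange_big /=.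
  apply: eq_bigr => c c0; rewrite -mulr_sumr -e //; exact: YZ.
(* If [r] is 0, then [0 < N - d <= q - 2] for all [d < N], so no form of degree less than [N] has
   the weight of [N], and any function of this weight that is not zero on [Y] will do. *)
case: (posnP r) => [r0|rgt].
  exists (fun p => p e0 ^+ N); split=> [c p c0 Yp|h fh e]; first by rewrite exprMn.
  have := avg_sum _ h p0 _ fh Yp0 e; rewrite big1.
    move=> h0; have /eqP : p0 e0 ^+ N = 0.
      by apply: h0 => c p c0 Yp; rewrite exprMn.
    by rewrite expf_eq0 (negPf (Y0 _ Yp0 _)) andbF.
  move=> d _; rewrite ifF //; apply/negP => dv.
  by have ltd := ltn_ord d; have le := @dvdn_leq q.-1 (N - d); lia.
have [phi [wphi nphi]] : exists phi, weighted Y r.-1 phi /\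
    ~ exists h, is_form r.-1 h /\ forall p, Y p -> h p = phi p.
  apply: NNPP => no; have /regY : full Y r.-1; last by lia.
  move=> phi wphi; apply: NNPP => nh; apply: no; exists phi; split=> //.
exists phi; split=> [|h fh e].
  apply: (weighted_eq _ wphi).
  by rewrite (_ : N = r.-1 + q.-1)%N ?modnDr //; lia.
apply: nphi.
(* The exponent [r.-1 - d] is a multiple of [q.-1], so the added power of [p e0] is 1 on [Y] and
   only brings all summands to degree [r.-1]. *)
exists (fun p => \sum_(d < N)
  if (q.-1 %| N - d)%N then h d p * p e0 ^+ (r.-1 - d) else 0); split.
  apply: is_form_sum => d _; case dv: (q.-1 %| N - d)%N; last exact: is_form0.
  have ed : (d + (r.-1 - d))%N = r.-1.
    have ltd := ltn_ord d; have le := @dvdn_leq q.-1 (N - d); lia.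
  by rewrite -[X in is_form X]ed; apply: is_formM; [exact: fh | exact: is_form_varX].
move=> p Yp; rewrite [RHS](avg_sum _ h) //.
  apply: eq_bigr => d _; case: ifP => // dv.
  rewrite expf_dvdn ?mulr1 ?Y0 //.
  have -> : (r.-1 - d = N - d - q.-1)%N by lia.
  by rewrite dvdn_sub.
apply: (weighted_eq _ wphi).
by rewrite (_ : N = r.-1 + q.-1)%N ?modnDr //; lia.
Qed.

(** Duality applied to the sums of forms of degree less than [N]. Membership in [A] constrains
    values on [Y] only, which forces [la] to be supported on [Y]. *)
Lemma annihilator : exists (phi : (E -> K) -> K) (la : {ffun E -> K} -> K),
  [/\ weighted Y N phi,
      forall y, la y != 0 -> Y y,
      forall d h, (d < N)%N -> is_form d h -> \sum_y la y * h y = 0 &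
      \sum_y la y * phi y != 0].
Proof.
have [phi [wphi nphi]] := not_sum_of_forms.
pose A (f : {ffun E -> K} -> K) := exists h : nat -> (E -> K) -> K,
  (forall d, is_form d (h d)) /\
  forall y : {ffun E -> K}, Y y -> f y = \sum_(d < N) h d y.
have [|c f g [h [fh eh]] [h' [fh' eh']]||la [laA laphi]] :=
    @dual_separation K {ffun E -> K} A phi.
- by exists (fun=> fun=> 0); split=> [d|y _]; [exact: is_form0 | rewrite big1].
- exists (fun d p => c * h d p + h' d p); split=> [d|y Yy]; first exact: is_formZD.
  by rewrite eh // eh' // mulr_sumr -big_split.
- case=> h [fh eh]; apply: (nphi h fh) => p Yp.
  have pE : p = [ffun e => p e] :> (E -> K).
    by apply: functional_extensionality => e; rewrite ffunE.
  rewrite pE; apply: eh; by rewrite -pE.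
exists phi, la; split=> // [y lay|d h ltd fh].
  apply: NNPP => nY; move: lay; rewrite -[la y]mulr1.
  have <- : \sum_z la z * (z == y)%:R = la y * 1.
    rewrite (bigD1 y) //= eqxx big1 ?addr0 // => z /negPf ->.
    by rewrite mulr0.
  rewrite laA ?eqxx //; exists (fun=> fun=> 0); split=> [d|z Yz]; first exact: is_form0.
  by rewrite big1 //; case: eqP => // ezy; rewrite ezy in Yz.
apply: laA; exists (fun d' p => if d' == d then h p else 0).
split=> [d'|y Yy]; first by case: eqP => [->|_]; [| exact: is_form0].
rewrite (bigD1 (Ordinal ltd)) //= eqxx big1 ?addr0 // => i.
by rewrite -val_eqE /= => /negPf ->.
Qed.

End Annihilator.

Section Product.

Variables (K : finFieldType) (E1 E2 E : finType) (g : E1 + E2 -> E).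
Hypothesis bij_g : bijective g.
Let g1 e := g (inl e).
Let g2 e := g (inr e).
Variables (Y1 : (E1 -> K) -> Prop) (Y2 : (E2 -> K) -> Prop).
Variable Y : (E -> K) -> Prop.
Hypothesis YE : forall p, Y p <-> Y1 (p \o g1) /\ Y2 (p \o g2).
Variables (a1 : E1) (a2 : E2).
Hypotheses (cone1 : torus_cone Y1) (cone2 : torus_cone Y2) (cone : torus_cone Y).
Local Notation q := #|K|.
Variables r1 r2 : nat.
Hypotheses (reg1 : regularity_index Y1 r1) (reg2 : regularity_index Y2 r2).

Lemma product_full d : (r1 + r2 + (q - 2) <= d)%N -> full Y d.
Proof.
have q1 := card_gt1 K => led.
apply: (separates_full (g1 a1) cone) => y /YE[Yy1 Yy2].
have [h1 h1P] : exists h : 'I_q.-1 -> (E1 -> K) -> K,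
    forall k : 'I_q.-1, is_form (r1 + k) (h k) /\ separates Y1 (y \o g1) (h k).
  apply: (@fin_all_exists 'I_q.-1 (fun=> (E1 -> K) -> K)
    (fun (k : 'I_q.-1) h => is_form (r1 + k) h /\ separates Y1 (y \o g1) h)) => k.
  have /reg1/(full_separates a1 cone1)/(_ Yy1)[h] := leq_addr k r1.
  by exists h.
have [h2 h2P] : exists h : 'I_q.-1 -> (E2 -> K) -> K,
    forall k : 'I_q.-1, is_form (d - r1 - k) (h k) /\ separates Y2 (y \o g2) (h k).
  apply: (@fin_all_exists 'I_q.-1 (fun=> (E2 -> K) -> K)
    (fun (k : 'I_q.-1) h => is_form (d - r1 - k) h /\ separates Y2 (y \o g2) h)) => k.
  have /reg2/(full_separates a2 cone2)/(_ Yy2)[h] : (r2 <= d - r1 - k)%N.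
    by have := ltn_ord k; lia.
  by exists h.
(* Each of the [q.-1] products is 1 at [y], so their sum is -1 there. *)
exists (fun p => (-1) * \sum_(k < q.-1) h1 k (p \o g1) * h2 k (p \o g2)).
  apply: is_formZ; apply: is_form_sum => k _.
  have e : (r1 + k + (d - r1 - k))%N = d by have := ltn_ord k; lia.
  rewrite -[X in is_form X]e.
  by apply: is_formM; [exact: is_form_comp (h1P k).1 | exact: is_form_comp (h2P k).1].
split.
  rewrite (eq_bigr (fun=> 1)) => [|k _]; last first.
    by have [_ [-> _]] := h1P k; have [_ [-> _]] := h2P k; rewrite mulr1.
  by rewrite sumr_const card_ord predn_card_natr mulN1r opprK.
move=> z /YE[Yz1 Yz2]; rewrite mulN1r oppr_eq0 => nz.
have [k0] : exists k, h1 k (z \o g1) * h2 k (z \o g2) != 0.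
  apply/existsP; apply: contraR nz; rewrite negb_exists => /forallP h.
  by rewrite big1 // => k _; apply/eqP; have := h k; rewrite negbK.
rewrite mulf_eq0 negb_or => /andP[n1 n2].
have [_ [_ /(_ _ Yz1 n1)[c1 c10 z1]]] := h1P k0.
have [_ [_ /(_ _ Yz2 n2)[c2 c20 z2]]] := h2P k0.
suff c12 : c1 = c2.
  exists c1 => //; apply: functional_extensionality => e.
  have [g' _ gK] := bij_g; rewrite -(gK e); case: (g' e) => e'.
    exact: (congr1 (fun f => f e') z1).
  by rewrite c12; exact: (congr1 (fun f => f e') z2).
(* At a point with components [c1] and [c2] times those of [y], the products form a geometric
   progression of ratio [c1 / c2], whose sum is 0 unless [c1 = c2]. *)
apply/eqP; apply: contraR nz => c12.
rewrite (eq_bigr (fun k : 'I_q.-1 => c1 ^+ r1 * c2 ^+ (d - r1) * (c1 / c2) ^+ k)).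
  rewrite -mulr_sumr sum_geometric ?mulf_neq0 ?invr_eq0 //.
  rewrite ifN ?mulr0 //; apply: contra c12 => /eqP e.
  by rewrite -(divfK c20 c1) e mul1r.
move=> k _; rewrite z1 z2; have [/is_form_scale -> [-> _]] := h1P k.
have [/is_form_scale -> [-> _]] := h2P k.
have -> : (d - r1 = d - r1 - k + k)%N by have := ltn_ord k; lia.
rewrite addnK !mulr1 !exprD exprMn exprVn; field.
by rewrite expf_neq0.
Qed.

Lemma product_not_full d : full Y d -> (r1 + r2 + (q - 2) <= d)%N.
Proof.
have q1 := card_gt1 K => fd; rewrite leqNgt; apply/negP => ltd.
(* Fullness persists in higher degrees, so it suffices to refute it just below the bound. *)
pose D := (r1 + r2 + (q - 2)).-1%N.
have {fd} fD : full Y D.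
  by apply: full_leq fd; [exact: (g1 a1) | exact: cone | rewrite /D; lia].
have [phi1 [la1 [wphi1 Yla1 ann1 nz1]]] := annihilator a1 cone1 reg1.
have [phi2 [la2 [wphi2 Yla2 ann2 nz2]]] := annihilator a2 cone2 reg2.
have [g' gK g'K] := bij_g.
pose join (y1 : E1 -> K) (y2 : E2 -> K) (e : E) : K :=
  match g' e with inl e1 => y1 e1 | inr e2 => y2 e2 end.
have join1 y1 y2 : join y1 y2 \o g1 = y1.
  by apply: functional_extensionality => e; rewrite /join /g1 /= gK.
have join2 y1 y2 : join y1 y2 \o g2 = y2.
  by apply: functional_extensionality => e; rewrite /join /g2 /= gK.
pose La (h : (E -> K) -> K) :=
  \sum_(y1 : {ffun E1 -> K}) \sum_(y2 : {ffun E2 -> K}) la1 y1 * la2 y2 * h (join y1 y2).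
have LaM h1 h2 : La (fun p => h1 (p \o g1) * h2 (p \o g2)) =
    (\sum_y la1 y * h1 y) * (\sum_y la2 y * h2 y).
  rewrite /La mulr_suml; apply: eq_bigr => y1 _; rewrite mulr_sumr.
  by apply: eq_bigr => y2 _; rewrite join1 join2; ring.
have La_ext h h' : h =1 h' -> La h = La h'.
  by move=> /functional_extensionality ->.
(* By induction on [h], its variables are moved one by one into [h1] or [h2]. In the end
   [d1 + d2 = D], so [d1 < r1 + (q - 2)] or [d2 < r2], and one of the two functionals vanishes. *)
have La_form d' h : is_form d' h -> forall d1 d2 h1 h2, (d' + d1 + d2 = D)%N ->
    is_form d1 h1 -> is_form d2 h2 ->
    La (fun p => h p * (h1 (p \o g1) * h2 (p \o g2))) = 0.
  elim=> [{}d'||{}d' e h' _ IH|{}d' c h' h'' _ IH' _ IH''] d1 d2 h1 h2 eD f1 f2.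
  - rewrite /La big1 // => y1 _; rewrite big1 // => y2 _.
    by rewrite mul0r mulr0.
  - rewrite (La_ext _ (fun p => h1 (p \o g1) * h2 (p \o g2))) => [|p];
      last by rewrite mul1r.
    rewrite LaM; case: (ltnP d1 (r1 + (q - 2))) => le1.
      by rewrite (ann1 _ _ le1 f1) mul0r.
    by rewrite (ann2 d2) ?mulr0 //; move: eD; rewrite /D; lia.
  - rewrite -(g'K e); case: (g' e) => e'.
      rewrite -(IH d1.+1 d2 (fun p => p e' * h1 p) h2) //; [|lia|exact: is_formX].
      by apply: La_ext => p; rewrite /g1 /=; ring.
    rewrite -(IH d1 d2.+1 h1 (fun p => p e' * h2 p)) //; [|lia|exact: is_formX].
    by apply: La_ext => p; rewrite /g2 /=; ring.
  transitivity (c * La (fun p => h' p * (h1 (p \o g1) * h2 (p \o g2))) +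
      La (fun p => h'' p * (h1 (p \o g1) * h2 (p \o g2)))).
    rewrite /La mulr_sumr -big_split; apply: eq_bigr => y1 _.
    by rewrite mulr_sumr -big_split; apply: eq_bigr => y2 _ /=; ring.
  by rewrite (IH' d1 d2) // (IH'' d1 d2) // mulr0 addr0.
(* The weights of the factors add up to [D + q.-1], so [phi] also has weight [D]. *)
pose phi p := phi1 (p \o g1) * phi2 (p \o g2).
have [|h [fh hY]] := fD phi.
  apply: (@weighted_eq _ _ _ (r1 + (q - 2) + (r2 + (q - 2)))).
    rewrite (_ : (r1 + (q - 2) + (r2 + (q - 2)) = D + q.-1)%N) ?modnDr //.
    by rewrite /D; lia.
  move=> c p c0 /YE[Yp1 Yp2]; rewrite /phi exprD.
  have -> : (fun e => c * p e) \o g1 = (fun e => c * (p \o g1) e) by [].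
  have -> : (fun e => c * p e) \o g2 = (fun e => c * (p \o g2) e) by [].
  by rewrite wphi1 // wphi2 //; ring.
have : La phi = La h.
  apply: eq_bigr => y1 _; apply: eq_bigr => y2 _.
  have [->|/Yla1 Yy1] := eqVneq (la1 y1) 0; first by rewrite !mul0r.
  have [->|/Yla2 Yy2] := eqVneq (la2 y2) 0; first by rewrite mulr0 !mul0r.
  by rewrite hY //; apply/YE; rewrite join1 join2.
rewrite LaM (La_ext h (fun p => h p * (1 * 1))) => [|p]; last by rewrite !mulr1.
rewrite (La_form D h fh 0%N 0%N (fun=> 1) (fun=> 1)) ?addn0 //; try exact: is_form1.
by move/eqP; rewrite mulf_eq0 (negPf nz1) (negPf nz2).
Qed.

Lemma product_regularity_index : regularity_index Y (r1 + r2 + (q - 2)).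
Proof. by move=> d; split; [exact: product_not_full | exact: product_full]. Qed.

End Product.

(** * Koszul homology of graded modules *)

Section HomogeneousParts.

Variables (K : fieldType) (n : nat).
Implicit Types (p q : {mpoly K[n]}) (e d : int).

(** Degrees are integers because differences of shifts may be negative. *)
Definition hpart e p : {mpoly K[n]} :=
  if e is Posz d then pihomog mdeg d p else 0.

Lemma mcoeff_hpart e p m : (hpart e p)@_m = p@_m *+ (e == (mdeg m)%:Z).
Proof.
case: e => d /=; last by rewrite mcoeff0.
elim/mpolyind: p => [|c m' p _ _ IH]; first by rewrite raddf0 mcoeff0 mul0rn.
rewrite linearP /= !mcoeffD !mcoeffZ IH mulrnDl; congr (_ + _).
rewrite pihomogX mcoeffX; case: ifP => [/eqP <-|dm]; rewrite ?mcoeffX ?mcoeff0.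
  case: (m' =P m) => [->|_]; first by rewrite eqxx.
  by rewrite mulr0 mul0rn.
case: (m' =P m) => [<-|_]; last by rewrite !mulr0 mul0rn.
by rewrite eqz_nat eq_sym dm mulr0.
Qed.

Lemma hpart_is_linear e : linear (hpart e).
Proof.
move=> a p q; apply/mpolyP => m.
by rewrite mcoeffD mcoeffZ !mcoeff_hpart mcoeffD mcoeffZ mulrnDl mulrnAr.
Qed.

HB.instance Definition _ e :=
  GRing.isLinear.Build K {mpoly K[n]} {mpoly K[n]} _ (hpart e)
    (hpart_is_linear e).

Lemma hpart_id e p : hpart e (hpart e p) = hpart e p.
Proof.
by apply/mpolyP => m; rewrite !mcoeff_hpart; case: eqP.
Qed.

Lemma homog_of_degreeE e p : homog_of_degree e p <-> hpart e p = p.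
Proof.
by case: e => d /=; [rewrite homog_piE; split=> [/eqP|/eqP] | split=> ->].
Qed.

Lemma homog_hpart e p : homog_of_degree e (hpart e p).
Proof. by apply/homog_of_degreeE; rewrite hpart_id. Qed.

Lemma hpart_homog_neq e d p : homog_of_degree d p -> e != d -> hpart e p = 0.
Proof.
move/homog_of_degreeE => <- ne; apply/mpolyP => m.
rewrite !mcoeff_hpart mcoeff0.
case: (e =P Posz (mdeg m)) ne => [->|_ _]; last by rewrite mulr0n.
by rewrite eq_sym => /negPf ->; rewrite mulr0n mul0rn.
Qed.

Lemma hpartM e d p q : homog_of_degree d q ->
  hpart e (p * q) = hpart (e - d) p * q.
Proof.
move=> /homog_of_degreeE hq.
rewrite [p]mpolyE mulr_suml !raddf_sum /= mulr_suml; apply: eq_bigr => m _.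
rewrite -scalerAl !linearZ /= -scalerAl; congr (_ *: _).
have -> : hpart (e - d) 'X_[m] = 'X_[m] *+ (e - d == (mdeg m)%:Z).
  apply/mpolyP => m1; rewrite mcoeff_hpart mcoeffMn mcoeffX.
  by case: (m =P m1) => [->|_] //; rewrite !mul0rn.
have hX : homog_of_degree (d + (mdeg m)%:Z) ('X_[m] * q).
  case: d hq => d /= hq; last first.
    by rewrite -hq mulr0; apply/homog_of_degreeE; rewrite raddf0.
  by rewrite addnC; apply: dhomogM; rewrite ?dhomogX // homog_piE hq.
have -> : (e - d == (mdeg m)%:Z) = (e == d + (mdeg m)%:Z).
  by rewrite subr_eq addrC.
case: eqP => [->|/eqP ne]; last by rewrite mul0r (hpart_homog_neq hX ne).
by move/homog_of_degreeE: hX.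
Qed.

Lemma hpart_sum (N : nat) p : (msize p <= N)%N ->
  p = \sum_(d < N) hpart d%:Z p.
Proof. by move=> le; apply: pihomog_partitionE. Qed.

End HomogeneousParts.

Definition is_submodule (R : pzRingType) (V : lmodType R) (Z : V -> Prop) :=
  Z 0 /\ forall a u v, Z u -> Z v -> Z (a *: u + v).

Section Submodule.

Variables (R : pzRingType) (V : lmodType R) (Z : V -> Prop).
Hypothesis subZ : is_submodule Z.

Lemma submodule0 : Z 0. Proof. by case: subZ. Qed.

Lemma submoduleZ a u : Z u -> Z (a *: u).
Proof.
by move=> Zu; rewrite -[_ *: _]addr0; apply: subZ.2 => //; exact: submodule0.
Qed.

Lemma submoduleD u v : Z u -> Z v -> Z (u + v).
Proof. by move=> Zu Zv; rewrite -[u]scale1r; apply: subZ.2. Qed.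

Lemma submoduleN u : Z u -> Z (- u).
Proof. by rewrite -scaleN1r; exact: submoduleZ. Qed.

Lemma submoduleB u v : Z u -> Z v -> Z (u - v).
Proof. by move=> Zu /submoduleN; exact: submoduleD. Qed.

Lemma submodule_sum (I : finType) (F : I -> V) :
  (forall i, Z (F i)) -> Z (\sum_i F i).
Proof.
by move=> ZF; apply: (big_ind Z) => //; [exact: submodule0 | exact: submoduleD].
Qed.

End Submodule.

Section Koszul.

Variables (R : comNzRingType) (T : eqType) (t : T -> R).

(* The Koszul complex of t_i, i in s, with coefficients in V, all homological
   degrees together: that of i :: s is the cone of t_i on that of s. *)
Fixpoint kos (V : lmodType R) (s : seq T) : lmodType R :=
  if s is _ :: s' then (kos V s' * kos V s')%type else V.

Section Complex.

Variable V : lmodType R.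

Fixpoint kd s : kos V s -> kos V s :=
  if s is i :: s' then fun w => (kd w.1 + t i *: w.2, - kd w.2)
  else fun=> 0.

Lemma kd_is_linear s : linear (@kd s).
Proof.
elim: s => [|i s IH] /= a u v; first by rewrite scaler0 addr0.
congr pair; rewrite /= IH.
  rewrite !scalerDr -!addrA; congr (_ + _); rewrite addrCA; congr (_ + _).
  by rewrite scalerA mulrC -scalerA.
by rewrite opprD scalerN.
Qed.

HB.instance Definition _ s :=
  GRing.isLinear.Build R (kos V s) (kos V s) _ (@kd s) (@kd_is_linear s).

Lemma kd_kd s (w : kos V s) : kd (kd w) = 0.
Proof.
elim: s w => [|i s IH] //= w; congr pair; rewrite /=.
  by rewrite linearD linearZ /= IH add0r scalerN subrr.
by rewrite linearN /= IH !oppr0.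
Qed.

(* kbot and ktop are the components in homological degrees 0 and size s; kinbot
   and kintop are the corresponding inclusions. *)
Fixpoint kbot s : kos V s -> V :=
  if s is _ :: s' then fun w => kbot w.1 else id.

Lemma kbot_is_linear s : linear (@kbot s).
Proof. by elim: s => [|i s IH] //= a u v; exact: IH. Qed.

HB.instance Definition _ s :=
  GRing.isLinear.Build R (kos V s) V _ (@kbot s) (@kbot_is_linear s).

Fixpoint ktop s : kos V s -> V :=
  if s is _ :: s' then fun w => ktop w.2 else id.

Lemma ktop_is_linear s : linear (@ktop s).
Proof. by elim: s => [|i s IH] //= a u v; exact: IH. Qed.

HB.instance Definition _ s :=
  GRing.isLinear.Build R (kos V s) V _ (@ktop s) (@ktop_is_linear s).

Lemma ktop_kd s (w : kos V s) : ktop (kd w) = 0.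
Proof. by elim: s w => [|i s IH] //= w; rewrite linearN /= IH oppr0. Qed.

Fixpoint kinbot s (v : V) : kos V s :=
  if s is _ :: s' then (kinbot s' v, 0) else v.

Fixpoint kintop s (v : V) : kos V s :=
  if s is _ :: s' then (0, kintop s' v) else v.

Lemma kd_kinbot s v : kd (kinbot s v) = 0.
Proof. by elim: s => [|i s IH] //=; rewrite IH scaler0 linear0 addr0 oppr0. Qed.

Lemma kbot_kinbot s v : kbot (kinbot s v) = v.
Proof. by elim: s. Qed.

Lemma ktop_kintop s v : ktop (kintop s v) = v.
Proof. by elim: s. Qed.

(** The subcomplex with coefficients in [Z]. Computing modulo [kall Z] gives the Koszul complex of
    [V / Z] without forming quotient modules. *)
Fixpoint kall (Z : V -> Prop) s : kos V s -> Prop :=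
  if s is _ :: s' then fun w => kall Z w.1 /\ kall Z w.2 else Z.

Lemma kall_submodule Z s : is_submodule Z -> is_submodule (@kall Z s).
Proof.
move=> subZ; elim: s => [|i s IH] //=.
by split=> [|a u v [Zu1 Zu2] [Zv1 Zv2]] /=; split=> //=;
  solve [exact: submodule0 | exact: IH.2].
Qed.

Lemma kall_kd Z s (w : kos V s) : is_submodule Z -> kall Z w -> kall Z (kd w).
Proof.
move=> subZ; elim: s w => [|i s IH] /= w; first by move=> _; exact: submodule0.
case=> Z1 Z2; split; last by apply: submoduleN; [exact: kall_submodule|exact: IH].
by rewrite addrC; apply: (kall_submodule _ subZ).2 => //; exact: IH.
Qed.

Lemma kall_kbot Z s (w : kos V s) : kall Z w -> Z (kbot w).
Proof. by elim: s w => [|i s IH] //= w [/IH]. Qed.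

Lemma kall_ktop Z s (w : kos V s) : kall Z w -> Z (ktop w).
Proof. by elim: s w => [|i s IH] //= w [_ /IH]. Qed.

Lemma kall_kinbot (Z : V -> Prop) s v : Z 0 -> Z v -> kall Z (kinbot s v).
Proof.
move=> Z0 Zv; elim: s => [|i s IH] //=; split=> //.
by elim: {IH} s => [|j s IH] //=.
Qed.

Lemma kall_imply (Z Z' : V -> Prop) s (w : kos V s) :
  (forall v, Z v -> Z' v) -> kall Z w -> kall Z' w.
Proof.
by move=> ZZ'; elim: s w => [|i s IH] /= w; [exact: ZZ' | case=> /IH ? /IH].
Qed.

End Complex.

Section Map.

Variables (V W : lmodType R) (f : {linear V -> W}).

Fixpoint kmap s : kos V s -> kos W s :=
  if s is _ :: s' then fun w => (kmap w.1, kmap w.2) else f.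

Lemma kmap_is_linear s : linear (@kmap s).
Proof.
elim: s => [|i s IH] /= a u v; first exact: linearP.
by congr pair; rewrite /= IH.
Qed.

HB.instance Definition _ s :=
  GRing.isLinear.Build R (kos V s) (kos W s) _ (@kmap s) (@kmap_is_linear s).

Lemma kmap_kd s (w : kos V s) : kmap (kd w) = kd (kmap w).
Proof.
elim: s w => [|i s IH] /= w; first by rewrite linear0.
by congr pair; rewrite /= ?linearN ?linearD ?linearZ /= !IH.
Qed.

Lemma kbot_kmap s (w : kos V s) : kbot (kmap w) = f (kbot w).
Proof. by elim: s w => [|i s IH] /=. Qed.

Lemma kall_im Z s (w : kos W s) :
  kall (fun v => exists2 u, Z u & v = f u) w <->
  exists2 u, kall Z u & w = kmap u.
Proof.
elim: s w => [|i s IH] //= [w1 w2] /=; split=> [[/IH[u1 Z1 ->] /IH[u2 Z2 ->]]|].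
  by exists (u1, u2).
by case=> -[u1 u2] [/= Z1 Z2] [-> ->]; split; apply/IH; [exists u1|exists u2].
Qed.

Lemma kall_preim Z s (w : kos V s) :
  kall (fun v => Z (f v)) w <-> kall Z (kmap w).
Proof. by elim: s w => [|i s IH] //= w; split=> -[/IH ? /IH]. Qed.

End Map.

Lemma kall0 (V : lmodType R) s (w : kos V s) : kall (fun v => v = 0) w <-> w = 0.
Proof.
elim: s w => [|i s IH] //= [w1 w2]; split=> /= [[/IH -> /IH ->] //|[-> ->]].
by split; apply/IH.
Qed.

Lemma kbot_kd (V : lmodType R) (P : V -> Prop) s (w : kos V s) :
  is_submodule P -> (forall i v, i \in s -> P (t i *: v)) -> P (kbot (kd w)).
Proof.
move=> subP; elim: s w => [|i s IH] /= w Pt; first exact: submodule0.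
rewrite linearD linearZ /=; apply: submoduleD => //.
  by apply: IH => j v js; apply: Pt; rewrite inE js orbT.
by apply: Pt; rewrite inE eqxx.
Qed.

(* [J s] stands for the submodule generated by the t_i v with i in s; the
   hypotheses say that the t_i form a regular sequence on V. *)
Lemma kos_exact (V : lmodType R) (J : seq T -> V -> Prop) :
  (forall v, J [::] v -> v = 0) -> (forall s, is_submodule (J s)) ->
  (forall s i v, i \in s -> J s (t i *: v)) ->
  (forall s i v, i \notin s -> J s (t i *: v) -> J s v) ->
  (forall s i v, J (i :: s) v -> exists u, J s (v - t i *: u)) ->
  forall s (w : kos V s), uniq s -> kd w = 0 -> J s (kbot w) ->
  exists u, w = kd u.
Proof.
move=> J0 subJ JX Jreg Jdiv.
have Jbot s (w : kos V s) : J s (kbot (kd w)).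
  by apply: kbot_kd => // i v; exact: JX.
elim=> [|i s IH] /= w; first by move=> _ _ /J0 ->; exists 0.
case: w => a b /= /andP[nis us] [dab db] Jw.
have {}db : kd b = 0 by apply/eqP; rewrite -oppr_eq0 db.
have Jb : J s (kbot b).
  apply: (Jreg _ i) => //.
  have -> : t i *: kbot b = - kbot (kd a).
    have /(congr1 (@kbot V s)) := dab.
    by rewrite linearD linearZ linear0 /= addrC => /eqP; rewrite addr_eq0 => /eqP.
  by apply: submoduleN => //; exact: Jbot.
have [b' eb] := IH b us db Jb.
have [v Jv] := Jdiv _ _ _ Jw.
(* The second summand is a cycle, so [kd b2] stays equal to [- b]; it is chosen to make
   [kbot (a - t i *: b2)] equal to [kbot a - t i *: v], which lies in [J s]. *)
pose b2 := - b' + kinbot s (v + kbot b').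
have db2 : kd b2 = - b by rewrite linearD linearN /= kd_kinbot addr0 -eb.
have [||a' ea] := IH (a - t i *: b2) us.
- by rewrite linearB linearZ /= db2 scalerN opprK.
- rewrite linearB linearZ /= linearD linearN /= kbot_kinbot.
  by rewrite addrCA addNr addr0.
by exists (a', b2); rewrite /= -ea subrK db2 opprK.
Qed.

Definition is_grading (V : lmodType R) (pi : int -> V -> V) :=
  [/\ forall e, {morph pi e : u v / u + v},
      forall e i v, pi e (t i *: v) = t i *: pi (e - 1) v &
      forall e v, pi e (pi e v) = pi e v].

(* The part in homological degree p and internal degree j, whose coefficients
   have degree j - p. *)
Fixpoint kproj (V : lmodType R) (pi : int -> V -> V) {s} (p j : int) :
    kos V s -> kos V s :=
  match s return kos V s -> kos V s with
  | [::] => fun w => if p == 0 then pi j w else 0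
  | _ :: _ => fun w => (kproj pi p j w.1, kproj pi (p - 1) (j - 1) w.2)
  end.

Section Graded.

Variables (V : lmodType R) (pi : int -> V -> V).
Hypothesis gr_pi : is_grading pi.

Lemma grading_sub e : {morph pi e : u v / u - v}.
Proof.
have [piD _ _] := gr_pi.
have pi0 : pi e 0 = 0.
  by apply: (addrI (pi e 0)); rewrite -piD !addr0.
move=> u v; rewrite piD; congr (_ + _); apply/eqP.
by rewrite -addr_eq0 -piD addNr pi0.
Qed.

Lemma kproj_is_additive s p j : zmod_morphism (kproj pi (s := s) p j).
Proof.
elim: s p j => [|i s IH] p j /= u v.
  by case: ifP; rewrite ?grading_sub // subr0.
by congr pair; rewrite /= IH.
Qed.

HB.instance Definition _ s p j :=
  GRing.isZmodMorphism.Build (kos V s) (kos V s) (kproj pi (s := s) p j)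
    (@kproj_is_additive s p j).

Lemma kprojB s p j : {morph @kproj V pi s p j : u v / u - v}.
Proof. exact: raddfB. Qed.

Lemma kprojD s p j : {morph @kproj V pi s p j : u v / u + v}.
Proof. exact: raddfD. Qed.

Lemma kprojZ s p j i (w : kos V s) :
  kproj pi p j (t i *: w) = t i *: kproj pi p (j - 1) w.
Proof.
have [_ piZ _] := gr_pi.
elim: s p j w => [|i' s IH] /= p j w; last by congr pair; rewrite /= IH.
by case: ifP; rewrite ?piZ ?scaler0.
Qed.

Lemma kproj_id s p j (w : kos V s) :
  kproj pi p j (kproj pi p j w) = kproj pi p j w.
Proof.
have [_ _ piK] := gr_pi.
elim: s p j w => [|i' s IH] /= p j w; last by congr pair; rewrite /= IH.
by case: (p == 0).
Qed.

Lemma kproj_kd s p j (w : kos V s) :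
  kproj pi p j (kd w) = kd (kproj pi (p + 1) j w).
Proof.
elim: s p j w => [|i s IH] /= p j w.
  by case: ifP; rewrite // -[X in pi _ X](subrr 0) grading_sub subrr.
congr pair; rewrite /= ?raddfN ?raddfD /= ?IH ?addrK ?subrK ?kprojZ //.
Qed.

Lemma kproj_gt s (p j : int) (w : kos V s) :
  (size s)%:Z < p -> kproj pi p j w = 0.
Proof.
elim: s p j w => [|i s IH] /= p j w ps; first by rewrite gt_eqF.
have ps' : (size s)%:Z + 1 < p by rewrite addrC -intS.
by congr pair; rewrite IH // ?ltrBrDr // (lt_trans _ ps') // ltrDl.
Qed.

Lemma kproj_lt0 s (p j : int) (w : kos V s) : p < 0 -> kproj pi p j w = 0.
Proof.
elim: s p j w => [|i s IH] /= p j w p0; first by rewrite lt_eqF.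
by congr pair; rewrite IH // ltrBlDr (lt_trans p0).
Qed.

Lemma kbot_kproj s p j (w : kos V s) :
  kbot (kproj pi p j w) = if p == 0 then pi j (kbot w) else 0.
Proof. by elim: s w => [|i s IH] /=. Qed.

Lemma kproj0_kinbot s j v : kproj pi 0 j (kinbot s v) = kinbot s (pi j v).
Proof. by elim: s => [|i s IH] //=; rewrite IH raddf0. Qed.

Lemma kproj_kintop s e v :
  kproj pi (size s)%:Z (e + (size s)%:Z) (kintop s v) = kintop s (pi e v).
Proof.
elim: s => [|i s IH] /=; first by rewrite addr0.
by rewrite raddf0 intS (addrC 1) addrA !addrK IH.
Qed.

Lemma kall_kproj Z s p j (w : kos V s) : is_submodule Z ->
  (forall e v, Z v -> Z (pi e v)) -> kall Z w -> kall Z (kproj pi p j w).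
Proof.
move=> subZ grZ; elim: s p j w => [|i s IH] /= p j w.
  by case: ifP => _ //; [exact: grZ | move=> _; exact: submodule0].
by case=> /IH ? /IH.
Qed.

End Graded.

Lemma kproj_kmap (V W : lmodType R) (f : {linear V -> W}) piV piW s p j
    (w : kos V s) : (forall e v, piW e (f v) = f (piV e v)) ->
  kproj piW p j (kmap f w) = kmap f (kproj piV p j w).
Proof.
move=> fpi; elim: s p j w => [|i s IH] /= p j w; last by rewrite !IH.
by case: ifP => // _; rewrite linear0.
Qed.

(* H_p(t_i, i in s; V / Z) vanishes in internal degree j. *)
Definition koszul_vanishes (V : lmodType R) (pi : int -> V -> V) (Z : V -> Prop)
    (s : seq T) (p j : int) :=
  forall w : kos V s, kproj pi p j w = w -> kall Z (kd w) ->
  exists u z, kall Z z /\ w = kd u + z.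

Section Shift.

Variables (V W : lmodType R) (piV : int -> V -> V) (piW : int -> W -> W).
Variables (f : {linear V -> W}) (J : W -> Prop) (s : seq T).
Hypotheses (gr_V : is_grading piV) (gr_W : is_grading piW).
Hypothesis f_gr : forall e v, piW e (f v) = f (piV e v).
Hypothesis subJ : is_submodule J.
Hypothesis J_exact : forall w : kos W s,
  kd w = 0 -> J (kbot w) -> exists u, w = kd u.
Hypothesis f_J : forall v, J (f v).

(* The long exact sequence of 0 -> im f -> W -> W / im f -> 0: exactness for W
   and [f_J] make the connecting map bijective in all degrees. *)
Lemma koszul_vanishes_shift p j : 0 <= p ->
  koszul_vanishes piW (fun w => exists v, w = f v) s (p + 1) j <->
  koszul_vanishes piV (fun v => f v = 0) s p j.
Proof.
move=> p0.
have imP s' (w : kos W s') :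
    kall (fun w => exists v, w = f v) w <-> exists u, w = kmap f u.
  split=> [Iw|[u ->]]; last first.
    by elim: s' {w} u => [|i s' IH] /= u; [exists u | split; exact: IH].
  have [] := (kall_im f (fun=> True) w).1; last by move=> u _; exists u.
  by apply: kall_imply Iw => v [u ->]; exists u.
have kerP s' (w : kos V s') : kall (fun v => f v = 0) w <-> kmap f w = 0.
  by rewrite (kall_preim f (fun w => w = 0)) kall0.
split=> van w hw.
- move=> /kerP; rewrite kmap_kd => dfw.
  have [|u0 eu] := J_exact dfw; first by rewrite kbot_kmap.
  pose u := kproj piW (p + 1) j u0.
  have du : kd u = kmap f w.
    by rewrite -kproj_kd // -eu (kproj_kmap _ _ _ f_gr) hw.
  have [||v [z [/imP[z' ->] euv]]] := van u.
  + by rewrite kproj_id.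
  + by apply/imP; exists w.
  exists z', (w - kd z'); split; last by rewrite addrC subrK.
  apply/kerP; rewrite linearB /= kmap_kd -du euv linearD /= kd_kd add0r.
  by rewrite subrr.
move=> /imP[u0 eu].
pose u := kproj piV p j u0.
have du : kd w = kmap f u.
  by rewrite -(kproj_kmap _ _ _ f_gr) -eu kproj_kd // hw.
have [||x [z [/kerP fz euv]]] := van u.
- by rewrite kproj_id.
- by apply/kerP; rewrite kmap_kd -du kd_kd.
have [||y ey] := @J_exact (w - kmap f x).
- by rewrite linearB /= du euv linearD /= fz addr0 kmap_kd subrr.
- rewrite linearB /= kbot_kmap -hw kbot_kproj.
  have -> : (p + 1 == 0) = false by apply: gt_eqF; exact: ltr_wpDl.
  by apply: submoduleB => //; exact: submodule0.
by exists y, (kmap f x); split; [apply/imP; exists x | rewrite -ey subrK].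
Qed.

(** Being surjective modulo [Z], [f] induces a graded isomorphism from [V] modulo the preimage of
    [Z] to [W / Z]. *)
Lemma koszul_vanishes_preim (Z : W -> Prop) p j : is_submodule Z ->
  (forall e w, Z w -> Z (piW e w)) ->
  (forall w, exists v, Z (w - f v)) ->
  koszul_vanishes piV (fun v => Z (f v)) s p j <->
  koszul_vanishes piW Z s p j.
Proof.
move=> subZ grZ surj.
have kZ := kall_submodule _ subZ.
have lift s' (w : kos W s') : exists u, kall Z (w - kmap f u).
  elim: s' w => [|i s' IH] /= w; first exact: surj.
  by have [u1 ?] := IH w.1; have [u2 ?] := IH w.2; exists (u1, u2).
split=> van w hw dw.
- have [u0 Zu0] := lift _ w; pose u := kproj piV p j u0.
  have Zu : kall Z (w - kmap f u).
    rewrite -hw -(kproj_kmap _ _ _ f_gr) -(kprojB gr_W).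
    exact: kall_kproj.
  have [||x [z [/kall_preim Zz euv]]] := van u.
  + by rewrite kproj_id.
  + apply/kall_preim; rewrite kmap_kd -[kmap f u](subKr w) linearB /=.
    by apply: submoduleB; [exact: kZ | | exact: kall_kd].
  exists (kmap f x), (w - kmap f u + kmap f z); split.
    by apply: submoduleD; [exact: kZ | |].
  by rewrite -kmap_kd addrCA -linearD /= -euv subrK.
have [||x [z [Zz ew]]] := van (kmap f w).
- by rewrite (kproj_kmap _ _ _ f_gr) hw.
- by rewrite -kmap_kd; apply/kall_preim.
have [y Zy] := lift _ x.
exists y, (w - kd y); split; last by rewrite addrC subrK.
apply/kall_preim; rewrite linearB /= ew kmap_kd addrAC -linearB /=.
by apply: submoduleD; [exact: kZ | exact: kall_kd |].
Qed.

End Shift.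

Section Cyclic.

Variables (V : lmodType R) (pi : int -> V -> V) (B : V -> Prop).
Hypotheses (gr_pi : is_grading pi) (subB : is_submodule B).
Hypothesis gr_B : forall e v, B v -> B (pi e v).
Variables (i : T) (s : seq T) (rho : int).
Hypothesis B_reg : forall v, B (t i *: v) -> B v.

Let kB s' := kall_submodule s' subB.

Lemma kall_reg s' (w : kos V s') : kall B (t i *: w) -> kall B w.
Proof.
elim: s' w => [|k s' IH] /= w; first exact: B_reg.
by case=> /IH ? /IH.
Qed.

(** Since [t i] is regular on [V / B], this homology is that of [V / (B + t_i V)] with respect to
    [s]. Its coefficients have degree [j - p], where this module is zero. *)
Lemma koszul_vanishes_gt p j :
  (forall e v, rho < e -> pi e v = v -> exists u, B (v - t i *: u)) ->
  rho < j - p -> koszul_vanishes pi B (i :: s) p j.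
Proof.
move=> hrho rhojp [a b] /= [ha hb] [dab db].
have lift s' p' j' (w : kos V s') : rho < j' - p' -> kproj pi p' j' w = w ->
    exists c, kall B (w - t i *: c).
  elim: s' p' j' w => [|k s' IH] /= p' j' w lt.
    case: (p' =P 0) lt => [->|_] lt hw; last first.
      by exists 0; rewrite -hw scaler0 subrr; exact: submodule0.
    by apply: (hrho j') => //; rewrite subr0 in lt.
  case: w => w1 w2 [h1 h2]; have [c1 ?] := IH _ _ _ lt h1.
  have [|c2 ?] := IH (p' - 1) (j' - 1) w2 _ h2.
    by rewrite opprB addrA subrK.
  by exists (c1, c2).
have [c Bc] := lift _ _ _ _ rhojp ha.
exists (0, c), (a - t i *: c, b + kd c); split; last first.
  by congr pair; rewrite /= ?linear0 ?add0r addrC ?subrK ?addrK.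
split=> //=; apply: kall_reg; rewrite scalerDr -linearZ /=.
have -> : t i *: b + kd (t i *: c) = (kd a + t i *: b) - kd (a - t i *: c).
  by rewrite linearB /= opprB [RHS]addrC addrA subrK addrC.
by apply: submoduleB; [exact: kB | | exact: kall_kd].
Qed.

(** The hypotheses make [v] a socle element of [V / (B + t_i V)]. Hence [kintop s v] is a cycle over
    this module, and no boundary, since boundaries have top component 0; completed by [b], it gives
    a cycle for [i :: s] over [V / B]. *)
Lemma koszul_not_vanishes v : pi rho v = v ->
  (forall u, ~ B (v - t i *: u)) ->
  (forall k, exists u, B (t k *: v - t i *: u)) ->
  ~ koszul_vanishes pi B (i :: s) (size s)%:Z (rho + (size s)%:Z).
Proof.
move=> hv nB sB van.
pose Q u := exists u', B (u - t i *: u').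
have subQ : is_submodule Q.
  split=> [|a u1 u2 [x1 B1] [x2 B2]].
    by exists 0; rewrite scaler0 subrr; exact: submodule0.
  exists (a *: x1 + x2); rewrite scalerDr opprD addrACA scalerA mulrC -scalerA.
  by rewrite -scalerBr; apply: subB.2.
have Qtop s' k : kall Q (t k *: kintop s' v : kos V s').
  elim: s' => [|k' s' IH] /=; first exact: sB.
  split=> //; rewrite scaler0; exact: submodule0 (kall_submodule _ subQ).
have Qdtop s' : kall Q (kd (kintop s' v : kos V s')).
  elim: s' => [|k' s' IH] /=; first exact: submodule0.
  rewrite linear0 add0r; split=> //.
  by apply: submoduleN => //; exact: kall_submodule.
have lift s' (w : kos V s') : kall Q w -> exists u, kall B (w - t i *: u).
  elim: s' w => [|k s' IH] //= w [/IH[u1 ?] /IH[u2 ?]].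
  by exists (u1, u2).
pose a : kos V s := kintop s v.
have [b0 Bb0] := lift _ _ (Qdtop s).
pose b := kproj pi ((size s)%:Z - 1) (rho + (size s)%:Z - 1) (- b0).
have ha : kproj pi (size s)%:Z (rho + (size s)%:Z) a = a.
  by rewrite kproj_kintop // hv.
have Bab : kall B (kd a + t i *: b).
  rewrite -ha -[in kd _](subrK 1 (size s)%:Z) -kproj_kd // -kprojZ // subrK.
  by rewrite -kprojD // scalerN; apply: kall_kproj.
have [||[u1 u2] [[z1 z2] [[Bz1 _] [ea _]]]] := van (a, b).
- by congr pair; [exact: ha | exact: kproj_id].
- split=> //=; apply: submoduleN; first exact: kB.
  apply: kall_reg; have -> : t i *: kd b = kd (kd a + t i *: b).
    by rewrite linearD linearZ /= kd_kd add0r.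
  exact: kall_kd.
apply: (nB (ktop u2)); move/(congr1 (@ktop V s)): ea.
rewrite ktop_kintop !linearD linearZ /= ktop_kd add0r => ->.
by rewrite addrC addKr; exact: kall_ktop.
Qed.

End Cyclic.

End Koszul.

(** * Graded free modules over the polynomial ring *)

Section FreeModules.

Variables (K : fieldType) (n : nat).
Local Notation S := {mpoly K[n]}.
Local Notation t := (fun i : 'I_n => 'X_i : S).

Lemma mcoeffXM (p : S) i (m : 'X_{1..n}) : ('X_i * p)@_(U_(i) + m) = p@_m.
Proof. by rewrite mulrC mcoeffMX. Qed.

Lemma mcoeffXM_eq0 (p : S) i (m : 'X_{1..n}) :
  m i = 0%N -> ('X_i * p)@_m = 0.
Proof.
move=> mi; rewrite mcoeffM big1 // => -[k1 k2] /= /eqP em.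
rewrite mcoeffX; case: eqP => [ek|_]; last by rewrite mul0r.
have := congr1 (fun k : 'X_{1..n} => k i) em.
by rewrite mi mnmDE -ek mnm1E eqxx.
Qed.

(** The quotient in the division of [p] by ['X_i]. *)
Lemma mpoly_divX (p : S) i :
  exists q : S, forall m : 'X_{1..n}, q@_m = p@_(U_(i) + m).
Proof.
elim/mpolyind: p => [|c m' p _ _ [q hq]]; first by exists 0 => m; rewrite !mcoeff0.
case: (posnP (m' i)) => mi.
  exists q => m; rewrite hq mcoeffD mcoeffZ mcoeffX.
  case: eqP => [em|_]; last by rewrite mulr0 add0r.
  by rewrite em mnmDE mnm1E eqxx in mi.
exists (c *: 'X_[(m' - U_(i))] + q) => m.
rewrite !mcoeffD hq !mcoeffZ !mcoeffX; congr (_ * _%:R + _).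
congr nat_of_bool; apply/eqP/eqP => [<-|->]; last by rewrite addmC addmK.
by rewrite addmC submK // lep1mP -lt0n.
Qed.

Variable m : nat.
Implicit Types (u v : 'rV[S]_m) (s : seq 'I_n).

(* Membership in the submodule generated by the 'X_i v with i in s. *)
Definition in_vars s v := forall l (k : 'X_{1..n}),
  (forall i, i \in s -> k i = 0%N) -> (v 0 l)@_k = 0.

Lemma in_vars_submodule s : is_submodule (in_vars s).
Proof.
split=> [l k _|a u v Ju Jv l k ks]; first by rewrite mxE mcoeff0.
rewrite !mxE mcoeffD Jv // addr0 mcoeffM big1 // => -[k1 k2] /= /eqP ek.
rewrite Ju ?mulr0 // => i /ks ki.
have /eqP := congr1 (fun k : 'X_{1..n} => k i) ek.
by rewrite ki mnmDE eq_sym addn_eq0 => /andP[_ /eqP].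
Qed.

Lemma in_vars_exact s (w : kos 'rV[S]_m s) : uniq s ->
  kd t w = 0 -> in_vars s (kbot w) -> exists u : kos 'rV[S]_m s, w = kd t u.
Proof.
apply: (@kos_exact _ _ t _ in_vars) => {s w}.
- by move=> v Jv; apply/rowP => l; apply/mpolyP => k; rewrite Jv // mxE mcoeff0.
- exact: in_vars_submodule.
- move=> s i v ins l k ks; rewrite mxE mcoeffXM_eq0 //; exact: ks.
- move=> s i v nis Jv l k ks; rewrite -(mcoeffXM _ i).
  have := Jv l (U_(i) + k)%MM; rewrite mxE; apply => i' i's.
  rewrite mnmDE mnm1E ks // addn0; case: eqP => // ei.
  by rewrite ei i's in nis.
move=> s i v Jv.
have [f fP] := fin_all_exists (fun l => mpoly_divX (v 0 l) i).
exists (\row_l f l) => l k ks; rewrite !mxE mcoeffB.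
case: (posnP (k i)) => ki.
  by rewrite mcoeffXM_eq0 // subr0 Jv // => i'; rewrite inE => /predU1P[->|/ks].
have -> : k = (U_(i) + (k - U_(i)))%MM.
  by rewrite addmC submK // lep1mP -lt0n.
by rewrite mcoeffXM fP subrr.
Qed.

(** The part of degree [e] in the direct sum of the [S(- sh l)]. *)
Definition row_part (sh : 'I_m -> int) (e : int) v : 'rV[S]_m :=
  \row_l hpart (e - sh l) (v 0 l).

Lemma row_part_grading sh : is_grading t (row_part sh).
Proof.
split=> [e u v|e i v|e v]; apply/rowP => l; rewrite !mxE ?linearD ?hpart_id //.
have hX : homog_of_degree 1 ('X_i : S) by rewrite /= dhomogX; apply/eqP; exact: mdeg1.
by rewrite mulrC (hpartM _ _ hX) addrAC mulrC.
Qed.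

End FreeModules.

Lemma koszul_vanishes_ext (R : comNzRingType) (T : eqType) (t : T -> R)
    (V : lmodType R) pi (Z Z' : V -> Prop) s p j :
  (forall v, Z v <-> Z' v) ->
  koszul_vanishes t pi Z s p j <-> koszul_vanishes t pi Z' s p j.
Proof.
move=> ZZ'; split=> van w hw dw;
  (have [|u [z [Zz ->]]] := van w hw; first by apply: kall_imply dw => v /ZZ');
  by exists u, z; split=> //; apply: kall_imply Zz => v /ZZ'.
Qed.

(** * Minimal generators and Koszul homology *)

Section Minimality.

Variables (K : fieldType) (n : nat).
Local Notation S := {mpoly K[n]}.
Local Notation t := (fun i : 'I_n => 'X_i : S).
Variable s : seq 'I_n.
Hypotheses (uniq_s : uniq s) (s_all : forall i, i \in s).

Lemma in_vars_allP m (v : 'rV[S]_m) :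
  in_vars s v <-> forall l, (v 0 l)@_0%MM = 0.
Proof.
split=> [Jv l|v0 l k ks]; first by apply: Jv => i _; rewrite mnm0E.
suff -> : k = 0%MM by [].
by apply/mnmP => i; rewrite ks // mnm0E.
Qed.

(** As [Z] lies in [(t_1, ..., t_n) V], H_0 of [V / Z] is [V / (t_1, ..., t_n) V], with a basis over
    [K] in the degrees [sh l]. *)
Lemma koszul_vanishes_generators m (sh : 'I_m -> int) (Z : 'rV[S]_m -> Prop) j :
  is_submodule Z -> (forall v, Z v -> forall l, (v 0 l)@_0%MM = 0) ->
  koszul_vanishes t (row_part sh) Z s 0 j <-> forall l, sh l != j.
Proof.
move=> subZ Zm; have gr := row_part_grading K n sh; split=> [van l|nosh w hw _].
  apply/eqP => shl.
  have [||u [z [Zz ew]]] := van (kinbot s (delta_mx 0 l)).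
  - rewrite (kproj0_kinbot gr); congr (kinbot _ _); apply/rowP => l'; rewrite !mxE.
    case: (l' =P l) => [->|_]; last by rewrite andbF raddf0.
    rewrite shl subrr /= pihomog_dE //; exact: dhomog1.
  - by rewrite kd_kinbot; apply: submodule0; exact: kall_submodule.
  have := congr1 (@kbot _ _ _ s) ew; rewrite linearD /= kbot_kinbot.
  move=> /rowP/(_ l)/(congr1 (mcoeff 0%MM)).
  rewrite !mxE !eqxx /= mcoeffD mcoeff1 eqxx (Zm _ (kall_kbot Zz)) addr0.
  suff /in_vars_allP -> : in_vars s (kbot (kd t u) : 'rV[S]_m).
    by move=> /eqP; rewrite oner_eq0.
  apply: kbot_kd => [|i v ins l' k ks].
    exact: in_vars_submodule.
  by rewrite mxE mcoeffXM_eq0 // ks.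
have dw0 : kd t w = 0 by rewrite -hw -[0](subrK 1) -kproj_kd // kproj_lt0.
have [|||u ->] := @in_vars_exact _ _ _ s w => //.
  apply/in_vars_allP => l; rewrite -hw kbot_kproj eqxx mxE mcoeff_hpart mdeg0.
  by rewrite subr_eq0 eq_sym (negPf (nosh l)).
exists u, 0; rewrite addr0; split=> //; apply: submodule0; exact: kall_submodule.
Qed.

(* Graded Nakayama, as H_1(V / Z) is Z / (t_1, ..., t_n) Z. *)
Lemma koszul_vanishes_generated m (sh : 'I_m -> int) (Z P : 'rV[S]_m -> Prop)
    (N : int) :
  is_submodule Z -> (forall e v, Z v -> Z (row_part sh e v)) ->
  (forall v, Z v -> forall l, (v 0 l)@_0%MM = 0) ->
  (forall j, N < j -> koszul_vanishes t (row_part sh) Z s 1 j) ->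
  is_submodule P ->
  (forall j v, j <= N -> Z v -> row_part sh j v = v -> P v) ->
  forall j v, Z v -> row_part sh j v = v -> P v.
Proof.
move=> subZ grZ Zm van subP low.
have gr := row_part_grading K n sh.
suff H k j v : (j <= N + k%:Z)%R -> Z v -> row_part sh j v = v -> P v.
  move=> j v; apply: (H `|j - N|%N).
  by rewrite -lerBlDl abszE ler_norm.
elim: k j v => [|k IH] j v; first by rewrite addr0; exact: low.
move=> lej Zv hv; case: (leP j N) => [leN|ltN]; first exact: (low j).
have kv : kproj (row_part sh) 0 j (kinbot s v) = kinbot s v.
  by rewrite (kproj0_kinbot gr) hv.
have [|||w0 ew0] := @in_vars_exact _ _ _ s (kinbot s v) => //.
- exact: kd_kinbot.
- by rewrite kbot_kinbot; apply/in_vars_allP; exact: Zm.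
(* [v] is the boundary of [w], which is a cycle modulo [Z]. Vanishing of H_1 replaces [w] by some
   [z] with coefficients in [Z] of degree [j - 1], to which the induction hypothesis applies. *)
pose w := kproj (row_part sh) 1 j w0.
have ew : kinbot s v = kd t w by rewrite -kv ew0 kproj_kd.
have [||u [z0 [Zz0 euz]]] := van j ltN w.
- by rewrite (kproj_id gr).
- by rewrite -ew; apply: kall_kinbot => //; exact: submodule0.
pose z := kproj (row_part sh) 1 j z0.
have ez : kinbot s v = kd t z.
  rewrite -kv ew euz linearD /= kd_kd add0r kproj_kd //.
have Zz : kall Z z by exact: kall_kproj.
have hz : kproj (row_part sh) 1 j z = z by rewrite (kproj_id gr).
rewrite -(kbot_kinbot s v) ez.
elim: (s) z Zz hz {ez} => [|i s' IHs] /= z; first by move=> _ _; exact: submodule0.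
case: z => a b /= [Za Zb] [ha hb]; rewrite linearD linearZ /=.
apply: submoduleD => //; first exact: IHs.
apply: submoduleZ => //; apply: (IH (j - 1)).
- by rewrite lerBlDr -addrA -PoszD addn1.
- exact: kall_kbot.
by rewrite -[in RHS]hb kbot_kproj.
Qed.

End Minimality.

(** * Minimal resolutions *)

(* The last two conditions say that rho is the top degree of S/(I + ('X_i0)). *)
Definition bounded_reduction (K : fieldType) n (I : {mpoly K[n]} -> Prop)
    (i0 : 'I_n) (rho : int) : Prop :=
  [/\ I 0 /\ forall a u v, I u -> I v -> I (a * u + v),
      forall e p, I p -> I (hpart e p),
      forall p, I ('X_i0 * p) -> I p,
      forall e p, rho < e -> hpart e p = p -> exists u, I (p - 'X_i0 * u) &
      exists2 p, hpart rho p = p & forall u, ~ I (p - 'X_i0 * u)].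

Section GradedMatrices.

Variables (K : fieldType) (n : nat).
Local Notation S := {mpoly K[n]}.

Lemma row_part_mulmx m1 m2 (sh1 : 'I_m1 -> int) (sh2 : 'I_m2 -> int)
    (A : 'M[S]_(m1, m2)) :
  (forall k l, homog_of_degree (sh1 k - sh2 l) (A k l)) ->
  forall e v, row_part sh2 e (v *m A) = row_part sh1 e v *m A.
Proof.
move=> hA e v; apply/rowP => l; rewrite !mxE linear_sum /=; apply: eq_bigr => k _.
by rewrite !mxE (hpartM _ _ (hA k l)) opprB addrA subrK.
Qed.

Lemma row_part_sum m (sh : 'I_m -> int) (v : 'rV[S]_m) :
  exists (D : nat) (c : int), v = \sum_(k < D) row_part sh (k%:Z - c) v.
Proof.
(* [c] bounds every shift, so all nonzero parts of [v] have degree at least [- c]. *)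
pose c := (\sum_l `|sh l|)%N.
have lec l : `|sh l| <= c%:Z by rewrite -abszE lez_nat /c (bigD1 l) //= leq_addr.
exists (\sum_l (msize (v 0%R l) + c + c))%N, c%:Z; apply/rowP => l; apply/mpolyP => k.
rewrite summxE linear_sum /=.
under eq_bigr do rewrite mxE mcoeff_hpart.
have [ink|/memN_msupp_eq0 ->] := boolP (k \in msupp (v 0 l)); last first.
  by rewrite big1 // => i _; rewrite mul0rn.
have /andP[ge0 le] : 0 <= (mdeg k)%:Z + sh l + c%:Z < (msize (v 0%R l) + c + c)%N%:Z.
  have := lec l; rewrite ler_norml => /andP[h1 h2]; apply/andP; split.
    by rewrite -addrA addr_ge0 // -lerBlDr sub0r.
  by rewrite !PoszD ltr_leD // ltr_leD // ltz_nat; apply: msize_mdeg_lt.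
case ed: ((mdeg k)%:Z + sh l + c%:Z) ge0 le => [d|//] _.
rewrite ltz_nat => ltd.
have ltd' : (d < \sum_l (msize (v 0%R l) + c + c))%N.
  by apply: leq_trans ltd _; rewrite [leqRHS](bigD1 l) //= leq_addr.
rewrite (bigD1 (Ordinal ltd')) //= -ed addrK addrK eqxx mulr1n big1 ?addr0 // => i.
rewrite -val_eqE /= => /negPf ne.
by rewrite !subr_eq ed eqz_nat ne.
Qed.

End GradedMatrices.

Section Regularity.

Variables (K : finFieldType) (n : nat) (I : {mpoly K[n]} -> Prop).
Variables (i0 : 'I_n) (rho : int).
Hypothesis redI : bounded_reduction I i0 rho.

Local Notation S := {mpoly K[n]}.
Local Notation t := (fun i : 'I_n => 'X_i : S).
Local Notation s := (i0 :: rem i0 (enum 'I_n)).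

Let B (v : 'rV[S]_1) := I (v 0 0).
Let deg1 := row_part (fun _ : 'I_1 => 0 : int) : int -> 'rV[S]_1 -> 'rV[S]_1.

Lemma vars_perm : perm_eq s (enum 'I_n).
Proof. by rewrite perm_sym perm_to_rem // mem_enum. Qed.

Lemma vars_uniq : uniq s.
Proof. by rewrite (perm_uniq vars_perm) enum_uniq. Qed.

Lemma vars_all i : i \in s.
Proof. by rewrite (perm_mem vars_perm) mem_enum. Qed.

Lemma size_vars : (size (rem i0 (enum 'I_n))).+1 = n.
Proof. by rewrite -[RHS]card_ord cardE -(perm_size vars_perm). Qed.

Lemma B_submodule : is_submodule B.
Proof.
case: redI => -[I0 Ilin] _ _ _ _; split=> [|a u v Bu Bv]; rewrite /B !mxE //.
exact: Ilin.
Qed.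

Lemma B_graded e v : B v -> B (deg1 e v).
Proof. by case: redI => _ grI _ _ _ Bv; rewrite /B mxE; exact: grI. Qed.

Lemma deg1P e (v : 'rV[S]_1) : deg1 e v = v <-> hpart e (v 0 0) = v 0 0.
Proof.
split=> [/rowP/(_ 0)|hv]; first by rewrite mxE subr0.
by apply/rowP => l; rewrite !mxE ord1 subr0.
Qed.

Lemma koszul_vanishes_large p j :
  rho < j - p -> koszul_vanishes t deg1 B s p j.
Proof.
case: redI => Iid grI Ireg Igt _.
apply: koszul_vanishes_gt => [|v|e v lte /deg1P hv].
- exact: B_submodule.
- by rewrite /B mxE; exact: Ireg.
have [u Iu] := Igt e _ lte hv.
by exists (\row__ u); rewrite /B !mxE.
Qed.

(** A form of degree [rho] outside [I + ('X_i0)] is a socle element there, because its multiples by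
    variables have degree [rho + 1]. The [n.-1] variables other than ['X_i0] account for the
    homological degree. *)
Lemma koszul_not_vanishes_last :
  ~ koszul_vanishes t deg1 B s (n.-1)%:Z (rho + (n.-1)%:Z).
Proof.
case: redI => Iid grI Ireg Igt [p hp nI].
rewrite -[in n.-1]size_vars /=.
apply: (@koszul_not_vanishes _ _ t _ deg1 B _ B_submodule _ i0 _ rho _ (\row__ p)).
- exact: row_part_grading.
- exact: B_graded.
- by move=> v; rewrite /B mxE; exact: Ireg.
- by apply/deg1P; rewrite !mxE.
- by move=> u; rewrite /B !mxE; exact: nI.
move=> k; have [u Iu] : exists u, I ('X_k * p - 'X_i0 * u).
  apply: (Igt (rho + 1)); first by rewrite ltrDl.
  have hX : homog_of_degree 1 ('X_k : S).
    by rewrite /= dhomogX; apply/eqP; exact: mdeg1.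
  by rewrite mulrC (hpartM _ _ hX) addrK hp.
by exists (\row__ u); rewrite /B !mxE.
Qed.

Section Resolution.

Variable F : graded_free_data K n.
Hypotheses (grF : is_graded F) (resF : is_resolution I F) (minF : is_minimal F).

Let im i (w : 'rV[S]_(rk F i)) := exists u : 'rV[S]_(rk F i.+1), w = u *m diff F i.

Lemma im_minimal i (w : 'rV[S]_(rk F i)) : im w -> forall l, (w 0 l : S)@_0%MM = 0.
Proof.
case=> u -> l; rewrite mxE linear_sum big1 // => k _.
by rewrite /= (mcoeff0_is_multiplicative n K).1 minF mulr0.
Qed.

Lemma im_submodule i : is_submodule (@im i).
Proof.
split=> [|a u v [x ->] [y ->]]; first by exists 0; rewrite mul0mx.
by exists (a *: x + y); rewrite mulmxDl scalemxAl.
Qed.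

(** For [i = 0] the augmentation identifies F_0 modulo the image of F_1 with S/I. Each further step
    is the shift along the sequence 0 -> F_{i+1} / im -> F_i -> F_i / im -> 0. *)
Lemma koszul_vanishes_resolution i p j : 0 <= p ->
  koszul_vanishes t (row_part (@shift _ _ F i)) (@im i) s p j <->
  koszul_vanishes t deg1 B s (p + i%:Z) j.
Proof.
case: resF => surj ker0 ker.
elim: i p => [|i IH] p p0.
  rewrite addr0; have e (w : 'rV[S]_(rk F _)) : im w <-> B (mulmxr (augm F) w).
    by rewrite /B /= ker0.
  rewrite (koszul_vanishes_ext _ _ _ _ _ e).
  apply: (@koszul_vanishes_preim _ _ t _ _ _ _ (mulmxr (augm F))) => [||||| w].
  - exact: row_part_grading.
  - exact: row_part_grading.
  - move=> e' v /=; apply: row_part_mulmx => k l; rewrite ord1 subr0.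
    exact: grF.2.
  - exact: B_submodule.
  - exact: B_graded.
  - by have [u Iu] := surj (w 0 0); exists u; rewrite /B /= !mxE in Iu *.
rewrite intS addrA -IH ?ler_wpDr //.
have e (w : 'rV[S]_(rk F _)) : im w <-> mulmxr (diff F i) w = 0 by rewrite /= ker.
rewrite (koszul_vanishes_ext _ _ _ _ _ e); symmetry.
apply: (@koszul_vanishes_shift _ _ t _ _ _ _ (mulmxr (diff F i)) (in_vars s)) => //.
- exact: row_part_grading.
- exact: row_part_grading.
- by move=> e' v; apply: row_part_mulmx => k l; exact: grF.1.
- exact: in_vars_submodule.
- by move=> w dw Jw; apply: in_vars_exact => //; exact: vars_uniq.
- by move=> v; apply/(in_vars_allP vars_all)/im_minimal; exists v.
Qed.

(** Both sides say that H_0 of F_i / im is nonzero in degree [j]. So the positions of the nonzero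
    Betti numbers depend on [I] only. *)
Lemma generatorsP i j :
  betti F i j != 0%N <-> ~ koszul_vanishes t deg1 B s i%:Z j.
Proof.
rewrite -[i%:Z]add0r -koszul_vanishes_resolution //.
rewrite (koszul_vanishes_generators vars_uniq vars_all); last exact: im_minimal.
  rewrite /betti cards_eq0; split=> [/set0Pn[k]|nall].
    by rewrite inE => /eqP <- /(_ k); rewrite eqxx.
  apply/eqP => e; apply: nall => l; have := in_set0 l.
  by rewrite -e inE => ->.
exact: im_submodule.
Qed.

Lemma resolution_max_degree : is_max_degree F rho.
Proof.
split=> [|i j /generatorsP nv].
  exists n.-1, (rho + (n.-1)%:Z); split; last by rewrite addrK.
  by apply/generatorsP; exact: koszul_not_vanishes_last.
by rewrite leNgt; apply/negP => lt; apply: nv; exact: koszul_vanishes_large.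
Qed.

(** The Koszul complex of [n] variables is zero in homological degrees above [n]. *)
Lemma resolution_finite : has_finite_length F.
Proof.
exists n => i lt; apply/eqP; rewrite -leqn0 leqNgt; apply/negP => rk0.
suff : betti F i (@shift _ _ F i (Ordinal rk0)) != 0%N.
  move=> /generatorsP; apply => w hw _.
  exists 0, 0; rewrite linear0 addr0; split.
    by apply: submodule0; apply: kall_submodule; exact: B_submodule.
  by rewrite -hw kproj_gt //= size_vars ltz_nat.
apply/eqP => /eqP; rewrite cards_eq0 => /eqP/setP/(_ (Ordinal rk0)).
by rewrite !inE eqxx.
Qed.

End Resolution.

Section Step.

Variables (m : nat) (sh : 'I_m -> int) (Z : 'rV[S]_m -> Prop) (N : int).
Hypothesis subZ : is_submodule Z.
Hypothesis grZ : forall e v, Z v -> Z (row_part sh e v).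
Hypothesis Zm : forall v, Z v -> forall l, (v 0 l)@_0%MM = 0.
Hypothesis van :
  forall j, N < j -> koszul_vanishes t (row_part sh) Z s 1 j.

Definition generated_by m' (sh' : 'I_m' -> int) (A : 'M[S]_(m', m)) :=
  (forall k l, homog_of_degree (sh' k - sh l) (A k l)) /\
  (forall v, Z v <-> exists u : 'rV_m', v = u *m A).

(* K being finite, the elements of Z of degree at most N can all be listed. *)
Lemma finitely_generated : exists m' sh' A, @generated_by m' sh' A.
Proof.
(* The coordinate [l] of an element of degree at most [N] has degree at most [N - sh l], hence less
   than [D]. *)
pose D := (\sum_l `|(N - sh l)%R|).+1%N.
pose T := {ffun 'I_m * 'X_{1..n < D} -> K}.
pose vec (f : T) : 'rV[S]_m := \row_l \sum_b f (l, b) *: 'X_[bmnm b].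
have pickP (f : T) : exists ev : int * 'rV[S]_m,
    [/\ Z ev.2, row_part sh ev.1 ev.2 = ev.2 &
      forall e, Z (vec f) -> row_part sh e (vec f) = vec f -> vec f = ev.2].
  case: (excluded_middle_informative
    (exists e, Z (vec f) /\ row_part sh e (vec f) = vec f)) => [[e [Zf ef]]|no].
    by exists (e, vec f).
  (* Where [vec f] is not a homogeneous element of [Z], the zero vector is listed as a redundant
     generator of degree 0. *)
  exists (0, 0); split=> /=; first exact: submodule0.
    by apply/rowP => l; rewrite !mxE raddf0.
  by move=> e Zf ef; case: no; exists e.
have [g gP] := fin_all_exists pickP.
exists #|T|, (fun k => (g (enum_val k)).1), (\matrix_k (g (enum_val k)).2).
split=> [k l|v].
  apply/homog_of_degreeE; rewrite mxE.
  by have [_ /rowP/(_ l) + _] := gP (enum_val k); rewrite mxE.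
pose P (v : 'rV[S]_m) :=
  exists u : 'rV_#|T|, v = u *m (\matrix_k (g (enum_val k)).2).
have subP : is_submodule P.
  split=> [|a x y [u ->] [w ->]]; first by exists 0; rewrite mul0mx.
  by exists (a *: u + w); rewrite mulmxDl -scalemxAl.
split=> [Zv|[u ->]]; last first.
  rewrite mulmx_sum_row; apply: submodule_sum => // k.
  by apply: submoduleZ => //; rewrite rowK; case: (gP (enum_val k)).
suff homP j x : Z x -> row_part sh j x = x -> P x.
  have [M [c ->]] := row_part_sum sh v; apply: (submodule_sum subP) => k.
  apply: (homP (k%:Z - c)); first exact: grZ.
  by case: (row_part_grading K n sh) => _ _; apply.
apply: (koszul_vanishes_generated vars_uniq vars_all subZ grZ Zm van subP).
move=> {}j {}x lej Zx hx.
pose f : T := [ffun lb => (x 0 lb.1)@_(bmnm lb.2)].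
have fx : vec f = x.
  apply/rowP => l; rewrite mxE.
  under eq_bigr do rewrite ffunE /=.
  apply/esym/mpolywE; rewrite msizeE; apply/bigmax_leqP_seq => /= b bx _.
  rewrite ltnS /D (bigD1 l) //=; apply: leq_trans (leq_addr _ _).
  move: bx; rewrite -[x]hx mcoeff_msupp mxE mcoeff_hpart.
  case: (j - sh l =P (mdeg b)%:Z) => [ejb _|_]; last by rewrite mulr0n eqxx.
  rewrite -lez_nat -ejb abszE; apply: le_trans (ler_norm _).
  by rewrite lerD2r.
exists (delta_mx 0 (enum_rank f)); rewrite -rowE rowK enum_rankK.
by case: (gP f) => _ _ /(_ j); rewrite fx; apply.
Qed.

(** The number of generators is taken least: a relation with a nonzero constant term in some
    coordinate would express that generator by the others. *)
Lemma minimal_generators : exists m' sh' A,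
  @generated_by m' sh' A /\
  forall u : 'rV_m', u *m A = 0 -> forall l, (u 0 l)@_0%MM = 0.
Proof.
have [m0 P0] := finitely_generated.
pose P m' := if excluded_middle_informative (exists sh' A, @generated_by m' sh' A)
  then true else false.
have PP m' : reflect (exists sh' A, @generated_by m' sh' A) (P m').
  by rewrite /P; case: excluded_middle_informative => ?; constructor.
have exP : exists m', P m' by exists m0; apply/PP.
case: (ex_minnP exP) => m' /PP[sh' [A [grA genA]]] min.
exists m', sh', A; split=> // u uA0 l; apply/eqP/negPn/negP => ul.
case: m' l sh' A grA genA min u uA0 ul => [[]//|m'] l sh' A grA genA min u uA0 ul.
suff : P m' by move/min; rewrite ltnn.
apply/PP; exists (sh' \o lift l), (row' l A); split.
  by move=> k l'; rewrite mxE; exact: grA.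
have row'P (x : 'rV[S]_m'.+1) : x 0 l = 0 -> x *m A = col' l x *m row' l A.
  move=> xl; apply/rowP => l'; rewrite !mxE (bigD1_ord l) //= xl mul0r add0r.
  by apply: eq_bigr => k _; rewrite !mxE.
pose c := (u 0 l)@_0%MM.
(* This homogeneous part of [u] is again a relation, and its coordinate [l] is the constant [c],
   which is invertible. *)
pose u' := row_part sh' (sh' l) u.
have u'l : u' 0 l = c%:MP.
  apply/mpolyP => k; rewrite mxE subrr mcoeff_hpart mcoeffC /c.
  by rewrite eq_sym eqz_nat mdeg_eq0; case: eqP => [->|]; rewrite ?mulr1 ?mulr0.
have u'A : u' *m A = 0.
  rewrite -(row_part_mulmx grA) uA0.
  by apply/rowP => l'; rewrite !mxE raddf0.
move=> v; rewrite genA; split=> -[x ->].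
  pose y := x - (x 0 l * (c^-1)%:MP) *: u'.
  have yl : y 0 l = 0.
    by rewrite !mxE in u'l *; rewrite u'l -mulrA -mpolyCM mulVf // mulr1 subrr.
  exists (col' l y); rewrite -row'P //.
  by rewrite mulmxBl -scalemxAl u'A scaler0 subr0.
pose y : 'rV[S]_m'.+1 := \row_k (if unlift l k is Some k' then x 0 k' else 0).
exists y; rewrite row'P; last by rewrite mxE unlift_none.
by congr (_ *m _); apply/rowP => k; rewrite !mxE liftK.
Qed.

End Step.

Lemma mul_castmx1 m (e : m = 1%N) (w : 'rV[S]_m) :
  w *m castmx (esym e, erefl) (1%:M : 'cV[S]_1) = castmx (erefl, e) w.
Proof. by subst m; rewrite !castmx_id mulmx1. Qed.

(* A truncation of a resolution, of which only the last free module F_i and the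
   kernel of F_i -> F_{i-1} are remembered; st_reg is rho + i. *)
Record stage := Stage {
  st_rk : nat;
  st_shift : 'I_st_rk -> int;
  st_syz : 'rV[S]_st_rk -> Prop;
  st_reg : int;
  st_sub : is_submodule st_syz;
  st_gr : forall e v, st_syz v -> st_syz (row_part st_shift e v);
  st_min : forall v, st_syz v -> forall l, (v 0 l)@_0%MM = 0;
  st_van : forall p j, 0 <= p -> st_reg < j - p ->
    koszul_vanishes t (row_part st_shift) st_syz s p j
}.

Lemma stage0 : exists st : stage, exists e : st_rk st = 1%N,
  (forall k, @st_shift st k = 0) /\
  (forall v, @st_syz st v <-> B (castmx (erefl, e) v)).
Proof.
(* An element of [I] with nonzero constant term would put 1 into [I], contrary to the existence of
   an element outside [I + ('X_i0)]. *)
have Bm v : B v -> forall l, (v 0 l)@_0%MM = 0.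
  move=> Bv l; rewrite ord1; apply/eqP/negPn/negP => v0.
  case: redI => -[I0 Ilin] Igr _ _ [p _ /(_ 0)]; apply; rewrite mulr0 subr0.
  have := Ilin (p * ((v 0 0)@_0%MM)^-1%:MP) _ 0 (Igr 0 _ Bv) I0.
  suff -> : hpart 0 (v 0 0) = ((v 0 0)@_0%MM)%:MP.
    by rewrite -mulrA -mpolyCM mulVf // mulr1 addr0.
  apply/mpolyP => k; rewrite mcoeff_hpart mcoeffC.
  by rewrite eq_sym eqz_nat mdeg_eq0; case: eqP => [->|]; rewrite ?mulr1 ?mulr0.
exists (@Stage _ _ _ _ B_submodule B_graded Bm
  (fun p j _ => @koszul_vanishes_large p j)).
by exists erefl; split=> // v; rewrite castmx_id.
Qed.

(** The new module is free on a minimal generating set of the syzygies. Vanishing of H_1 above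
    degree [st_reg st + 1] makes this set finite, and the shift gives the vanishing for the new
    syzygies. *)
Lemma next_stage (st : stage) : exists (st' : stage)
    (A : 'M[S]_(st_rk st', st_rk st)),
  [/\ forall k l, homog_of_degree (@st_shift st' k - @st_shift st l) (A k l),
      forall v, @st_syz st v <-> exists u, v = u *m A &
      forall u, @st_syz st' u <-> u *m A = 0].
Proof.
case: st => m sh Z N subZ grZ Zm van.
have [|m' [sh' [A [[grA genA] minA]]]] :=
  @minimal_generators m sh Z (N + 1) subZ grZ Zm.
  by move=> j lt; apply: van; rewrite // ltrBrDr.
pose Z' (u : 'rV[S]_m') := u *m A = 0.
have subZ' : is_submodule Z'.
  split=> [|a u v Zu Zv]; rewrite /Z' ?mul0mx //.
  by rewrite mulmxDl -scalemxAl Zu Zv scaler0 addr0.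
have grZ' e v : Z' v -> Z' (row_part sh' e v).
  rewrite /Z' -(row_part_mulmx grA) => ->.
  by apply/rowP => l; rewrite !mxE raddf0.
have vanZ' p j : 0 <= p -> N + 1 < j - p ->
    koszul_vanishes t (row_part sh') Z' s p j.
  move=> p0 lt.
  apply/(@koszul_vanishes_shift _ _ t _ _ _ (row_part sh) (mulmxr A) (in_vars s))
    => //.
  - exact: row_part_grading.
  - exact: row_part_grading.
  - by move=> e v; exact: row_part_mulmx.
  - exact: in_vars_submodule.
  - by move=> w dw Jw; apply: in_vars_exact => //; exact: vars_uniq.
  - by move=> v; apply/(in_vars_allP vars_all)/Zm/genA; exists v.
  rewrite -(koszul_vanishes_ext _ _ _ _ _ genA); apply: van.
    by rewrite addr_ge0.
  by rewrite opprD addrA ltrBrDr.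
by exists (@Stage m' sh' Z' (N + 1) subZ' grZ' minA vanZ'), A.
Qed.

Lemma resolution_exists : exists F : graded_free_data K n,
  [/\ is_graded F, is_resolution I F & is_minimal F].
Proof.
have [st0 [e [sh0 Z0]]] := stage0.
pose nx st := constructive_indefinite_description _ (next_stage st).
pose st i := iter i (fun st => projT1 (nx st)) st0.
pose A i : 'M[S]_(st_rk (st i.+1), st_rk (st i)) :=
  projT1 (constructive_indefinite_description _ (projT2 (nx (st i)))).
have AP i := projT2 (constructive_indefinite_description _ (projT2 (nx (st i)))).
exists (@GradedFreeData K n (fun i => st_rk (st i)) (fun i => @st_shift (st i)) A
  (castmx (esym e, erefl) (1%:M : 'cV[S]_1))).
split.
- split=> [i k l|k] /=; first by case: (AP i) => h _ _; exact: h.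
  rewrite sh0 castmxE /= !ord1 mxE eqxx; exact: dhomog1.
- have augE (w : 'rV[S]_(st_rk st0)) :
      w *m castmx (esym e, erefl) (1%:M : 'cV[S]_1) = castmx (erefl, e) w.
    exact: mul_castmx1.
  split=> [p|w|i w] /=.
  + exists (castmx (erefl, esym e) (\row__ p)); rewrite augE.
    rewrite castmxKV mxE subrr; case: redI => -[I0 _]; by [].
  + rewrite augE; case: (AP 0%N) => _ h _; rewrite -h; symmetry; exact: Z0.
  by case: (AP i) => _ _ h; case: (AP i.+1) => _ h' _; rewrite -h -h'.
move=> i k l /=; case: (AP i) => _ h _.
have Zk : @st_syz (st i) (row k (A i)).
  by apply/h; exists (delta_mx 0 k); rewrite rowE.
by have := st_min Zk l; rewrite mxE.
Qed.

Theorem regularity_bounded_reduction : regularity I = rho.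
Proof.
have [F [grF resF minF]] := resolution_exists.
(* The chosen value is witnessed by a resolution [F'] that may differ from [F], but whose maximal
   degree is [rho] as well. *)
have [|F' [grF' resF' _ minF' maxF']] := epsilon_spec (inhabits 0) (is_regularity I).
  exists rho, F; split=> //; [exact: resolution_finite | exact: resolution_max_degree].
have [[i [j [bij er]]] le] := maxF'.
have [[i' [j' [bij' er']]] le'] := resolution_max_degree grF' resF' minF'.
by apply/eqP; rewrite eq_le {1}/regularity er le' //= [X in X <= _]er' le.
Qed.

End Regularity.

(** * Vanishing ideals *)

Section VanishingIdeal.

Variables (K : finFieldType) (n : nat) (Y : ('I_n -> K) -> Prop).
Local Notation S := {mpoly K[n]}.

Lemma is_form_mpoly d (h : ('I_n -> K) -> K) : is_form d h ->
  exists2 f : S, f \is d.-homog & forall p, f.@[p] = h p.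
Proof.
elim=> [{}d||{}d i h' _ [f hf ef]|{}d c h1 h2 _ [f1 hf1 ef1] _ [f2 hf2 ef2]].
- by exists 0 => [|p]; rewrite ?meval0 ?rpred0.
- by exists 1 => [|p]; [exact: dhomog1 | rewrite meval1].
- exists ('X_i * f) => [|p]; last by rewrite mevalM mevalXU ef.
  by rewrite -add1n; apply: dhomogM => //; rewrite dhomogX; apply/eqP/mdeg1.
exists (c *: f1 + f2) => [|p]; last by rewrite mevalD mevalZ ef1 ef2.
by rewrite rpredD ?rpredZ.
Qed.

Lemma mpoly_is_form d (f : S) : f \is d.-homog -> is_form d (fun p => f.@[p]).
Proof.
move=> /dhomogP hf.
apply: (is_form_ext (h1 := fun p =>
    \sum_(m <- msupp f | m \in msupp f) f@_m * \prod_i p i ^+ m i)).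
  by move=> p; rewrite mevalE big_seq.
apply: is_form_sum => m /hf <-; apply: is_formZ.
by rewrite /= mdegE; apply: is_form_prod => i; exact: is_form_varX.
Qed.

(** The homogeneous parts of a combination of homogeneous generators are again such combinations,
    and [f] is the sum of its parts. *)
Lemma vanishing_idealP (f : S) : vanishing_ideal Y f <->
  forall e p, Y p -> (hpart e f).@[p] = 0.
Proof.
split=> [[k [g [h [hh ->]]]] e p Yp|van].
  rewrite raddf_sum raddf_sum big1 //= => i _.
  have [[d hd] vd] := hh i.
  by rewrite (@hpartM _ _ _ d%:Z) // mevalM vd // mulr0.
exists (msize f), (fun=> 1), (fun d => hpart (val d)%:Z f); split=> [d|].
  split; last by move=> p Yp; exact: van.
  by exists (val d); exact: (@homog_hpart _ _ (Posz (val d))).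
by under eq_bigr do rewrite mul1r; exact: hpart_sum.
Qed.

Variable i0 : 'I_n.
Hypothesis coneY : torus_cone Y.
Variable r : nat.
Hypothesis regY : regularity_index Y r.

Let homogX (i : 'I_n) : homog_of_degree 1 ('X_i : S).
Proof. by rewrite /= dhomogX; apply/eqP; exact: mdeg1. Qed.

Lemma hpart_hpart e e' (f : S) :
  hpart e (hpart e' f) = if e == e' then hpart e f else 0.
Proof.
case: eqP => [->|/eqP ne]; first exact: hpart_id.
exact: hpart_homog_neq (homog_hpart _ _) ne.
Qed.

Lemma hpartB e (f g : S) : hpart e (f - g) = hpart e f - hpart e g.
Proof. exact: raddfB. Qed.

Lemma hpartX e (f : S) i : hpart e ('X_i * f) = 'X_i * hpart (e - 1) f.
Proof. by rewrite mulrC (hpartM _ _ (homogX i)) mulrC. Qed.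

Lemma vanishing_ideal_bounded_reduction :
  bounded_reduction (vanishing_ideal Y) i0 r%:Z.
Proof.
have [[p0 Yp0] Y0 YZ] := coneY.
split.
- split=> [|a u v /vanishing_idealP hu /vanishing_idealP hv].
    by apply/vanishing_idealP => e p _; rewrite raddf0 meval0.
  apply/vanishing_idealP => e p Yp.
  rewrite raddfD mevalD hv // addr0.
  rewrite (hpart_sum (leqnn (msize u))) mulr_sumr !raddf_sum big1 //= => d _.
  by rewrite (hpartM _ _ (homog_hpart (val d)%:Z u)) mevalM (hu (val d)%:Z) // mulr0.
- move=> e f /vanishing_idealP hf; apply/vanishing_idealP => e' p Yp.
  by rewrite hpart_hpart; case: ifP => _; rewrite ?hf ?meval0.
- move=> f /vanishing_idealP hf; apply/vanishing_idealP => e p Yp.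
  have := hf (e + 1) p Yp; rewrite hpartX addrK mevalM mevalXU => /eqP.
  by rewrite mulf_eq0 (negPf (Y0 p Yp i0)) => /eqP.
- move=> [[//|e]|//] f; rewrite ltz_nat ltnS => /regY fe hf.
  have /mpoly_is_form fF : f \is e.+1.-homog.
    by have /homog_of_degreeE := hf.
  (* Since [Y] is full in degree [e], the quotient of [f] by ['X_i0] agrees on [Y] with a form [g],
     and [f - 'X_i0 * g] vanishes on [Y]. *)
  have [|h [/is_form_mpoly[g hg eg] hY]] := fe (fun p => f.@[p] / p i0).
    move=> c p c0 Yp; have := Y0 p Yp i0 => p0'.
    rewrite (is_form_scale _ _ fF) exprS; field.
    by rewrite c0 p0'.
  exists g; apply/vanishing_idealP => e' p Yp.
  rewrite hpartB hpartX mevalB mevalM mevalXU.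
  have [->|ne] := eqVneq e' e.+1%:Z.
    rewrite hf -addn1 PoszD addrK /= pihomog_dE // eg hY //.
    by rewrite mulrC divfK ?subrr ?Y0.
  rewrite -hf hpart_hpart (negPf ne) meval0 (@hpart_homog_neq _ _ _ e%:Z) //.
    by rewrite meval0 mulr0 subrr.
  by rewrite subr_eq -PoszD addn1.
case: r regY => [|r'] reg.
  exists 1 => [|u]; first by rewrite /= pihomog_dE ?dhomog1.
  move=> /vanishing_idealP/(_ 0 p0 Yp0).
  rewrite hpartB hpartX /= mulr0 subr0.
  by rewrite pihomog_dE ?dhomog1 // meval1 => /eqP; rewrite oner_eq0.
(* [phi] is no form of degree [r'], but its product with the coordinate [i0] is a form [f] of degree
   [r'.+1]. Were [f] in the ideal plus [('X_i0)], cancelling ['X_i0] would make [phi] a form. *)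
have [phi [wphi nphi]] : exists phi, weighted Y r' phi /\
    ~ exists h, is_form r' h /\ forall p, Y p -> h p = phi p.
  apply: NNPP => no; have /reg : full Y r'; last by rewrite ltnn.
  by move=> phi wphi; apply: NNPP => nh; apply: no; exists phi.
have /reg/(_ (fun p => p i0 * phi p)) [|h [/is_form_mpoly[f hf ef] hY]] := leqnn r'.+1.
  by move=> c p c0 Yp; rewrite wphi // exprS; ring.
exists f => [|u]; first by rewrite /= pihomog_dE.
move=> /vanishing_idealP hv; apply: nphi.
exists (fun p => (hpart r'%:Z u).@[p]); split.
  by apply: mpoly_is_form; exact: (@homog_hpart _ _ (Posz r')).
move=> p Yp; have := hv r'.+1%:Z p Yp.
rewrite hpartB hpartX.
have -> : hpart r'.+1%:Z f = f by exact: pihomog_dE.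
have -> : r'.+1%:Z - 1 = r'%:Z by rewrite -addn1 PoszD addrK.
rewrite mevalB mevalM mevalXU ef hY //.
by rewrite -mulrBr => /eqP; rewrite mulf_eq0 (negPf (Y0 p Yp i0)) subr_eq0 => /eqP.
Qed.

Lemma regularity_vanishing_ideal : regularity (vanishing_ideal Y) = r%:Z.
Proof.
exact: regularity_bounded_reduction vanishing_ideal_bounded_reduction.
Qed.

End VanishingIdeal.

(** * Parallel compositions of paths *)

Lemma toric_subset_cone (K : finFieldType) (G : mgraph) :
  torus_cone (@toric_subset K G).
Proof.
split.
- exists (fun=> 1), (fun=> 1), 1; split=> [v||i]; rewrite ?oner_eq0 //.
  by rewrite mul1r /edge_monomial big1.
- move=> p [x [c [x0 c0 ep]]] e; rewrite ep mulf_neq0 //.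
  by apply/prodf_neq0 => v _.
move=> a p a0 [x [c [x0 c0 ep]]]; exists x, (a * c); split=> // [|i].
  by rewrite mulf_neq0.
by rewrite ep mulrA.
Qed.

(* z i k is the value of x at the k-th vertex of the i-th path. *)
Definition path_parametrization (K : fieldType) (I : Type) (len : I -> nat)
    (p : {i : I & 'I_(len i)} -> K) :=
  exists (z : I -> nat -> K) (c : K),
    [/\ c != 0, forall i k, z i k != 0,
        forall i j, z i 0%N = z j 0%N /\ z i (len i) = z j (len j) &
        forall i (k : 'I_(len i)),
          p (existT _ i k) = c * (z i k * z i k.+1)].

Lemma toric_subset_paths (K : fieldType) (I : finType) (len : I -> nat)
    (G : mgraph) :
  is_parallel_composition_of_paths len G ->
  exists2 g : {i : I & 'I_(len i)} -> 'I_(nb_edges G), bijective g &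
    forall p : 'I_(nb_edges G) -> K,
      toric_subset p <-> path_parametrization (p \o g).
Proof.
case=> phi [psi [surj glue bij_psi endsE]].
exists (fun e => enum_rank (psi e)).
  exact: bij_comp (@enum_rank_bij _) bij_psi.
have monomialE x i (k : 'I_(len i)) :
    edge_monomial x (psi (existT _ i k)) =
    x (phi (existT _ i (inord k))) * x (phi (existT _ i (inord k.+1))) :> K.
  have path_endsE : path_ends k = [set inord k; inord k.+1].
    rewrite /path_ends; congr [set _; _]; apply: val_inj; rewrite /= inordK //.
      by rewrite ltnS ltnW.
    by rewrite ltnS.
  rewrite /edge_monomial endsE /= path_endsE imsetU1 imset_set1.
  (* Edges of [G] have two ends, so the two vertices keep distinct images and the monomial has two
     factors. *)
  have := card_ends (psi (existT _ i k)); rewrite endsE /= path_endsE.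
  rewrite imsetU1 imset_set1 cards2; case: eqP => // /eqP ne _.
  by rewrite big_setU1 ?inE //= big_set1.
move=> p; split=> [[x [c [x0 c0 ep]]]|[z [c [c0 z0 zends ep]]]].
  exists (fun i k => x (phi (existT _ i (inord k)))), c; split=> // [i j|i k].
    split; congr (x _); apply/glue; [constructor 2|constructor 3] => /=.
      by split; apply: val_inj; rewrite /= inordK.
    by split; apply: val_inj; rewrite /= inordK.
  by rewrite /= ep enum_rankK monomialE.
(* Each vertex of [G] takes the value of a chosen preimage; by [zends], the choice does not affect
   this value. *)
have [s sK] := fin_all_exists surj.
pose zv (u : {i : I & 'I_(len i).+1}) := z (tag u) (tagged u : 'I_(len (tag u)).+1).
pose x v := zv (s v).
have xE u : x (phi u) = zv u.
  rewrite /x /zv; have /glue[->//|[e1 e2]|[e1 e2]] := sK (phi u).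
    by rewrite e1 e2; case: (zends (tag (s (phi u))) (tag u)).
  by rewrite e1 e2; case: (zends (tag (s (phi u))) (tag u)).
exists x, c; split=> // [v|e]; first exact: z0.
have [psi' _ psi'K] := bij_psi.
rewrite -[e](enum_valK) enum_rankK -(psi'K (enum_val e)).
case: (psi' _) => i k; rewrite monomialE !xE /zv /= !inordK //.
- exact: ep.
- by rewrite ltnS.
by rewrite ltnS ltnW.
Qed.

Section MixedParity.

Variables (K : finFieldType) (I : finType) (len : I -> nat).
Local Notation odd_path := {i : I | odd (len i)}.
Local Notation even_path := {i : I | ~~ odd (len i)}.

Definition mixed_edge (e : {i : odd_path & 'I_(len (val i))} +
    {i : even_path & 'I_(len (val i))}) : {i : I & 'I_(len i)} :=
  match e with
  | inl (existT i k) => existT _ (val i) k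
  | inr (existT i k) => existT _ (val i) k
  end.

Lemma mixed_edge_bij : bijective mixed_edge.
Proof.
have surj (e : {i : I & 'I_(len i)}) : exists e', mixed_edge e' = e.
  case: e => i k; case: (boolP (odd (len i))) => oi.
    by exists (inl (existT (fun i : odd_path => 'I_(len (val i))) (exist _ i oi) k)).
  by exists (inr (existT (fun i : even_path => 'I_(len (val i))) (exist _ i oi) k)).
have [f fK] := fin_all_exists surj.
suff inj : injective mixed_edge by exists f => // e; apply: inj; exact: fK.
move=> [[[i oi] k]|[[i oi] k]] [[[j oj] l]|[[j oj] l]] /= e;
    have /= ij := congr1 tag e; subst j.
- by rewrite (bool_irrelevance oi oj) (eq_from_Tagged e).
- by have := oj; rewrite /= oi.
- by have := oi; rewrite /= oj.
by rewrite (bool_irrelevance oi oj) (eq_from_Tagged e).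
Qed.

(* Multiplying z by u at even and by v at odd positions of a path, and c by
   (u v)^-1, changes neither its edges nor, the length being even, the ratio of
   its end values; for odd length the end values are multiplied by u and v. *)
Lemma mixed_parametrization (p : {i : I & 'I_(len i)} -> K) :
  (exists i, odd (len i)) -> (exists i, ~~ odd (len i)) ->
  path_parametrization p <->
  path_parametrization (fun e => p (mixed_edge (inl e))) /\
  path_parametrization (fun e => p (mixed_edge (inr e))).
Proof.
move=> [io oio] [ie eie]; split=> [[z [c [c0 z0 zends zp]]]|].
  by split; exists (fun i => z (val i)), c; split=> // i k; exact: zp.
case=> -[z1 [c1 [c10 z10 ends1 p1]]] [z2 [c2 [c20 z20 ends2 p2]]].
pose i1 : odd_path := exist _ io oio; pose i2 : even_path := exist _ ie eie.
pose a1 := z1 i1 0%N; pose b1 := z1 i1 (len io).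
pose a2 := z2 i2 0%N; pose b2 := z2 i2 (len ie).
(* [u] and [v] carry the end values of the odd paths to those of the even paths. On the even paths
   the factor [c2 / c], at odd positions only, turns the constant [c2] into [c] and fixes the
   ends. *)
pose u := a2 / a1; pose v := b2 / b1; pose c := c1 / (u * v).
have [a10 b10] : a1 != 0 /\ b1 != 0 by split; exact: z10.
have [a20 b20] : a2 != 0 /\ b2 != 0 by split; exact: z20.
have u0 : u != 0 by rewrite mulf_neq0 ?invr_eq0.
have v0 : v != 0 by rewrite mulf_neq0 ?invr_eq0.
have c0 : c != 0 by rewrite mulf_neq0 // invr_eq0 mulf_neq0.
(* The default 1 is never reached, as [z] reads each function only on paths of its own parity. *)
pose z1' i k := if insub i is Some j then z1 j k else 1.
pose z2' i k := if insub i is Some j then z2 j k else 1.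
pose z i (k : nat) := if odd (len i) then z1' i k * (if odd k then v else u)
  else z2' i k * (if odd k then c2 / c else 1).
have zodd i (oi : odd (len i)) k :
    z i k = z1 (exist _ i oi) k * (if odd k then v else u).
  by rewrite /z /z1' oi insubT.
have zeven i (ei : ~~ odd (len i)) k :
    z i k = z2 (exist _ i ei) k * (if odd k then c2 / c else 1).
  by rewrite /z /z2' (negPf ei) insubT.
have zends i : z i 0%N = a2 /\ z i (len i) = b2.
  case: (boolP (odd (len i))) => oi.
    rewrite !(zodd i oi) /= oi; have [-> /= ->] := ends1 (exist _ i oi) i1.
    by rewrite -/a1 -/b1 /u /v; split; field.
  rewrite !(zeven i oi) /= (negPf oi) !mulr1.
  exact: (ends2 (exist _ i oi) i2).
exists z, c; split=> // [i k|i j|i k].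
- case: (boolP (odd (len i))) => oi; rewrite ?(zodd i oi) ?(zeven i oi) mulf_neq0 //.
    by case: ifP.
  by case: ifP => _; rewrite ?oner_eq0 // mulf_neq0 // invr_eq0.
- by have [-> ->] := zends i; have [-> ->] := zends j.
case: (boolP (odd (len i))) => oi.
  rewrite !(zodd i oi) (p1 (exist _ i oi) k) /= /c.
  by case: (odd k) => /=; field; rewrite u0 v0.
rewrite !(zeven i oi) (p2 (exist _ i oi) k) /=.
by case: (odd k) => /=; field.
Qed.

End MixedParity.

Theorem theorem1p2 (K : finFieldType) (r : nat) (hr : (2 <= r)%N)
  (len : 'I_r -> nat) (len_gt0 : forall i, (0 < len i)%N)
  (some_odd : exists i, odd (len i)) (some_even : exists i, ~~ odd (len i))
  (G H1 H2 : mgraph)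
  (hG : is_parallel_composition_of_paths len G)
  (hH1 : is_parallel_composition_of_paths
           (fun i : {i : 'I_r | odd (len i)} => len (val i)) H1)
  (hH2 : is_parallel_composition_of_paths
           (fun i : {i : 'I_r | ~~ odd (len i)} => len (val i)) H2) :
  regularity (vanishing_ideal (@toric_subset K G)) =
    regularity (vanishing_ideal (@toric_subset K H1)) +
    regularity (vanishing_ideal (@toric_subset K H2)) + (#|K|%:Z - 2).
Proof.
have [g bij_g gP] := toric_subset_paths K hG.
have [g1 [f1 g1K f1K] g1P] := toric_subset_paths K hH1.
have [g2 [f2 g2K f2K] g2P] := toric_subset_paths K hH2.
have [io oio] := some_odd; have [ie eie] := some_even.
(* Both parities occur and lengths are positive, so each of [H1] and [H2] has an edge, whose
   variable is invertible on the cone. *)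
pose e1 := g1 (existT _ (exist _ io oio) (Ordinal (len_gt0 io))).
pose e2 := g2 (existT _ (exist _ ie eie) (Ordinal (len_gt0 ie))).
pose f (e : 'I_(nb_edges H1) + 'I_(nb_edges H2)) :=
  match e with inl e => inl (f1 e) | inr e => inr (f2 e) end.
pose h e := g (mixed_edge (f e)).
have bij_h : bijective h.
  apply: (bij_comp bij_g); apply: (bij_comp (@mixed_edge_bij _ len)).
  exists (fun e => match e with inl e => inl (g1 e) | inr e => inr (g2 e) end).
    by case=> e /=; rewrite ?f1K ?f2K.
  by case=> e /=; rewrite ?g1K ?g2K.
have YE p : @toric_subset K G p <->
    @toric_subset K H1 (p \o (fun e => h (inl e))) /\
    @toric_subset K H2 (p \o (fun e => h (inr e))).
  rewrite gP g1P g2P mixed_parametrization //.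
  have -> : (p \o (fun e => h (inl e))) \o g1 =
      fun e => (p \o g) (mixed_edge (inl e)).
    by apply: functional_extensionality => e; rewrite /h /= g1K.
  have -> // : (p \o (fun e => h (inr e))) \o g2 =
      fun e => (p \o g) (mixed_edge (inr e)).
  by apply: functional_extensionality => e; rewrite /h /= g2K.
have cone H := @toric_subset_cone K H.
have [r1 reg1] := regularity_index_exists e1 (cone H1).
have [r2 reg2] := regularity_index_exists e2 (cone H2).
have reg := product_regularity_index bij_h YE e1 e2
  (cone H1) (cone H2) (cone G) reg1 reg2.
rewrite (regularity_vanishing_ideal e1 (cone H1) reg1).
rewrite (regularity_vanishing_ideal e2 (cone H2) reg2).
rewrite (regularity_vanishing_ideal (h (inl e1)) (cone G) reg).
(* As [q >= 2], the truncated [q - 2] is the integer difference. *)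
by rewrite !PoszD subzn // card_gt1.
Qed.
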